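(* Let $G$ be a cyclically $4$-edge-connected cubic graph of girth $5$ on $n$ vertices that is not isomorphic to the Petersen graph. Then $G$ has a $2$-factor that contains at most $n/10$ circuits of length $5$.
   Context: A graph is cyclically $4$-edge-connected if no set of fewer than $4$ edges separates it into two components each of which contains a circuit. A $2$-factor is a spanning $2$-regular subgraph, i.e. a spanning collection of vertex-disjoint circuits (cycles). *)

(* Defs.v *)
From mathcomp Require Import all_boot.

Set Implicit Arguments.
Unset Strict Implicit.
Unset Printing Implicit Defensive.

(* Only simple graphs are considered: loops and parallel edges are circuits of
   length 1 and 2, so a graph of girth 5 is necessarily simple. *)
Record sgraph := SGraph {
  vertex :> finType;
  adj : rel vertex;
  adj_sym : symmetric adj;
  adj_irr : irreflexive adj }.

Section Graphs.
Variable G : sgraph.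
Implicit Types (c : seq G) (E F M : {set {set G}}).

Definition edges : {set {set G}} :=
  [set [set p.1; p.2] | p : G * G & adj p.1 p.2].

Definition regular (k : nat) : Prop := forall x : G, #|[set y | adj x y]| = k.

(* A circuit is presented by the cyclic list of its (distinct) vertices; its
   length is the size of the list. *)
Definition circuit c : bool := (2 < size c) && ucycleb (@adj G) c.

Definition girth_is (g : nat) : Prop :=
  (exists2 c, circuit c & size c = g) /\ (forall c, circuit c -> g <= size c).

Definition circuit_edges c : {set {set G}} := [set [set x; next c x] | x in c].

(* Circuits as subgraphs: the rotations and reflections of a cyclic list have
   the same edge set, so they count as one circuit. *)
Definition circuits_of_length (k : nat) : {set {set {set G}}} :=
  [set circuit_edges c | c : k.-tuple G & circuit c].

Definition components : {set {set G}} :=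
  equivalence_partition (connect (@adj G)) [set: G].

Definition contains_circuit (A : {set G}) : Prop :=
  exists2 c, circuit c & {subset c <= A}.

Definition spanning_adj E (x y : G) : bool :=
  adj x y && ([set x; y] \in E).

Lemma spanning_adj_sym E : symmetric (spanning_adj E).
Proof. by move=> x y; rewrite /spanning_adj adj_sym setUC. Qed.

Lemma spanning_adj_irr E : irreflexive (spanning_adj E).
Proof. by move=> x; rewrite /spanning_adj adj_irr. Qed.

Definition spanning_subgraph E : sgraph :=
  SGraph (spanning_adj_sym E) (spanning_adj_irr E).

End Graphs.

Definition delete_edges (G : sgraph) (F : {set {set G}}) : sgraph :=
  spanning_subgraph (~: F).

Definition cyclically_edge_connected (k : nat) (G : sgraph) : Prop :=
  forall F : {set {set G}}, F \subset edges G -> #|F| < k ->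
  ~ exists A B : {set delete_edges F},
      [/\ A \in components (delete_edges F),
          B \in components (delete_edges F),
          A != B,
          contains_circuit A
        & contains_circuit B].

(* A 2-factor is given by its edge set. *)
Definition two_factor (G : sgraph) (M : {set {set G}}) : Prop :=
  M \subset edges G /\ regular (spanning_subgraph M) 2.

Definition isomorphic (G H : sgraph) : Prop :=
  exists2 f : G -> H, bijective f & forall x y, adj (f x) (f y) = adj x y.

(* The Petersen graph as the Kneser graph K(5,2). *)
Definition petersen_vertex : finType := {A : {set 'I_5} | #|A| == 2}.

Definition petersen_adj (A B : petersen_vertex) : bool :=
  [disjoint val A & val B].

Lemma petersen_adj_sym : symmetric petersen_adj.
Proof. by move=> A B; rewrite /petersen_adj disjoint_sym. Qed.

Lemma petersen_adj_irr : irreflexive petersen_adj.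
Proof.
case=> A cardA; rewrite /petersen_adj -setI_eq0 setIid.
by apply/negbTE; rewrite -cards_eq0 (eqP cardA).
Qed.

Definition petersen : sgraph := SGraph petersen_adj_sym petersen_adj_irr.

(* Main.v *)
Require Import Defs.
From mathcomp Require Import all_boot.
From mathcomp Require Import all_order all_algebra.
From mathcomp Require Import ring lra zify.

Set Implicit Arguments.
Unset Strict Implicit.
Unset Printing Implicit Defensive.

Import Order.TTheory GRing.Theory Num.Theory.

(* By Edmonds' theorem the constant 1/3 lies in the perfect matching polytope of G, since every
   odd cut has at least three edges; so for any edge costs some perfect matching costs at most
   a third of the total.  Charge each 5-circuit C with the number of matching edges leaving it:
   this is 1, 3 or 5, it is 5 when C lies in the complementary 2-factor, and its average is at
   most 5/3.  Hence some 2-factor contains at most a sixth of all 5-circuits.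

   If n >= 16 there are at most 3n/5 circuits of length 5, i.e. an average vertex lies on at most
   three of them.  A vertex v lying on k of them has a ball of radius 2 with 10 vertices and
   12 - 2k outgoing edges, so k <= 4.  If k = 4, the absence of small cuts leaves three possible
   balls, and in each v can pass its excess to vertices opposite to v on a common 5-circuit that
   lie on at most two 5-circuits.  For n = 12, 14 the bound k <= 4 suffices, and n = 10 forces
   the Petersen graph. *)

(** * The perfect matching polytope *)

Section Polytope.
Local Open Scope ring_scope.
Variable V : finType.
Implicit Types (A S T : {set V}) (x w d : V -> V -> rat) (m : V -> V).

(** 5-circuits are counted as closed 5-walks, that is as 5-tuples of vertices, so that all double
    counting is done with plain sums. Girth 5 makes each such walk a circuit, and a circuit yields
    ten walks, two from each of its vertices. With [W] walks in all and [Z] walks left by every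
    matching edge that meets them, the two averages read [6 * Z <= W] and [W <= 6 * n]; the ten
    walks per circuit give the 10 of the theorem. The bound k <= 4 alone gives 4n/5 circuits and
    hence 2n/15 of them in a 2-factor, which suffices only where rounding helps: 2n/15 < 2 for n =
    12 and 14. Discharging has to gain the rest. Its structural input is that a set with at least
    three vertices on either side has at least four outgoing edges, as otherwise both sides would
    contain circuits. The largest set to which this is applied is a ball of ten vertices with three
    more; it leaves three vertices outside as soon as n >= 16. Edmonds' theorem is proved in its
    optimization form: for each cost, some perfect matching in the support of [x] costs no more than
    [x]. No convex decomposition is built. *)

Definition cut x A S : rat := \sum_(u in S) \sum_(v in A :\: S) x u v.

(** The perfect matching polytope of the complete graph on [A]; the support of [x] plays the role of
    a graph. The odd-cut condition includes [S = A], whose cut is empty, and so forces [#|A|] to be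
    even. *)
Definition fractional_matching A x : Prop :=
  [/\ forall u v, x u v = x v u, forall u v, 0 <= x u v, forall u, x u u = 0,
      forall u, u \in A -> \sum_(v in A) x u v = 1
    & forall S, S \subset A -> odd #|S| -> 1 <= cut x A S].

(** A matching is the map to the partner. Positivity on the support excludes fixed points, since [x]
    vanishes on the diagonal. *)
Definition matching_in A x m : Prop :=
  forall u, u \in A -> [/\ m u \in A, m (m u) = u & 0 < x u (m u)].

Definition value A x w : rat := \sum_(u in A) \sum_(v in A) x u v * w u v.

(** Costs live on ordered pairs: on both sides of the inequality an edge [uv] is charged
    [w u v + w v u]. *)
Definition cheap_matching A x : Prop :=
  forall w, exists2 m, matching_in A x m
    & \sum_(u in A) w u (m u) <= value A x w.

Lemma weighted_average_le (I : finType) (P : pred I) (g h : I -> rat) (c : rat) :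
  (forall i, P i -> 0 <= g i) -> \sum_(i | P i) g i = 1 ->
  \sum_(i | P i) g i * h i <= c -> exists i, [/\ P i, 0 < g i & h i <= c].
Proof.
move=> g0 g1 gh.
case: (pickP (fun i => [&& P i, 0 < g i & h i <= c])) => [i /and3P[]|no].
  by exists i.
have lt_gh i : P i -> g i * c <= g i * h i.
  move=> Pi; have := no i; rewrite Pi /= => /negbT; rewrite negb_and.
  case/orP => [|/negbTE hi].
    rewrite -leNgt => gi; have -> : g i = 0 by apply/eqP; rewrite eq_le gi g0.
    by rewrite !mul0r.
  by apply: ler_wpM2l; [apply: g0|apply: ltW; rewrite ltNge hi].
have [i Pi gi] : exists2 i, P i & 0 < g i.
  case: (pickP (fun i => P i && (0 < g i))) => [i /andP[]|no2]; first by exists i.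
  move: g1; rewrite big1 => [/eqP|i Pi]; first by rewrite eq_sym oner_eq0.
  apply/eqP; rewrite eq_le g0 // andbT leNgt.
  by have := no2 i; rewrite Pi /= => ->.
have : \sum_(i | P i) g i * c < \sum_(i | P i) g i * h i.
  rewrite (bigD1 i) //= [ltRHS](bigD1 i) //=; apply: ltr_leD.
    have := no i; rewrite Pi gi /= => /negbT; rewrite -ltNge => hi.
    by rewrite ltr_pM2l.
  by apply: ler_sum => j /andP[Pj _]; apply: lt_gh.
by rewrite -mulr_suml g1 mul1r ltNge gh.
Qed.

(** The ratio test of linear programming: [e] is the least quotient [g i / - h i] over the
    decreasing constraints. *)
Lemma first_blocking (I : finType) (P : pred I) (g h : I -> rat) :
  (forall i, P i -> 0 < g i) -> (exists2 i, P i & h i < 0) ->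
  exists2 e, 0 <= e & (forall i, P i -> 0 <= g i + e * h i) /\
    (exists2 i, P i & g i + e * h i = 0).
Proof.
move=> g0 [i0 Pi0 hi0].
have Q0 : P i0 && (h i0 < 0) by rewrite Pi0.
case: (@Order.TotalTheory.arg_minP _ _ _ i0 (fun i => P i && (h i < 0))
  (fun i => g i / - h i) Q0) => i /andP[Pi hi] imin.
have e0 : 0 <= g i / - h i.
  by apply: divr_ge0; [apply: ltW; apply: g0|rewrite oppr_ge0 ltW].
exists (g i / - h i); first exact: e0.
split=> [j Pj|]; last first.
  by exists i => //; rewrite invrN mulrN mulNr divfK ?subrr // lt_eqF.
case: (ltP (h j) 0) => hj; last first.
  by apply: addr_ge0; [apply: ltW; apply: g0|apply: mulr_ge0].
have /(_ j) := imin; rewrite Pj hj => /(_ isT) le_ij.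
rewrite -subr_ge0 in le_ij.
have -> : g j + g i / - h i * h j = - h j * (g j / - h j - g i / - h i).
  by field; rewrite !lt_eqF.
by rewrite mulr_ge0 // oppr_ge0 ltW.
Qed.


Lemma sum_subset_split A S (F : V -> rat) : S \subset A ->
  \sum_(v in A) F v = \sum_(v in S) F v + \sum_(v in A :\: S) F v.
Proof. by move=> sSA; rewrite (big_setID S) (setIidPr sSA). Qed.

Lemma cutC A x S : (forall u v, x u v = x v u) -> S \subset A ->
  cut x A (A :\: S) = cut x A S.
Proof.
move=> xC sSA; rewrite /cut setDDr setDv set0U (setIidPr sSA) exchange_big.
by apply: eq_bigr => u _; apply: eq_bigr => v _; apply: xC.
Qed.

Lemma fractional_even A x : fractional_matching A x -> ~~ odd #|A|.
Proof.
case=> _ _ _ _ xodd; apply/negP => /(xodd A (subxx _)).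
rewrite /cut big1 ?ler10 // => u _.
by rewrite setDv big_set0.
Qed.

Lemma matching_inP A x m :
  reflect (matching_in A x m)
    [forall u in A, [&& m u \in A, m (m u) == u & 0 < x u (m u)]].
Proof.
apply: (iffP forall_inP) => mP u uA; first by have /and3P[? /eqP] := mP u uA.
by have [-> -> ->] := mP u uA; rewrite eqxx.
Qed.

Lemma eq_matching_in A x m m' : {in A, m =1 m'} ->
  matching_in A x m -> matching_in A x m'.
Proof.
move=> eqm mP u uA; have [muA mmu xmu] := mP u uA.
by rewrite -(eqm u uA) -(eqm _ muA).
Qed.

Lemma min_matching A x w m0 : matching_in A x m0 ->
  exists2 m, matching_in A x m &
    forall m', matching_in A x m' ->
      \sum_(u in A) w u (m u) <= \sum_(u in A) w u (m' u).
Proof.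
move=> m0P.
pose Q (f : {ffun V -> V}) :=
  [forall u in A, [&& f u \in A, f (f u) == u & 0 < x u (f u)]].
have toQ m : matching_in A x m -> Q (finfun m).
  by move=> mP; apply/matching_inP; apply: eq_matching_in mP => u _; rewrite ffunE.
case: (@Order.TotalTheory.arg_minP _ _ _ (finfun m0) Q
  (fun f : {ffun V -> V} => \sum_(u in A) w u (f u)) (toQ _ m0P)) => f Qf fmin.
exists f; first exact/matching_inP.
move=> m' /toQ /fmin /le_trans; apply.
by rewrite le_eqVlt; apply/orP; left; apply/eqP/eq_bigr => u _; rewrite ffunE.
Qed.

(** * Contraction of one side of a tight odd cut *)

Section Contraction.
Variables (A S : {set V}) (x : V -> V -> rat) (r : V).
Hypotheses (xA : fractional_matching A x) (sSA : S \subset A) (rT : r \in A :\: S)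
  (odd_S : odd #|S|) (tight : cut x A S = 1).

Let out u := \sum_(t in A :\: S) x u t.

(* The vertices outside [S] are merged into the representative [r]. *)
Definition contract u v :=
  if u == r then (if v == r then 0 else out v)
  else if v == r then out u else x u v.

Let rS : r \notin S. Proof. by move: rT; rewrite inE => /andP[]. Qed.
Let neq_r u : u \in S -> (u == r) = false.
Proof. by move=> uS; apply: contraNF rS => /eqP <-. Qed.

Lemma contract_in u v : u \in S -> v \in S -> contract u v = x u v.
Proof. by move=> uS vS; rewrite /contract !neq_r. Qed.

Lemma contract_out u : u \in S -> contract u r = out u.
Proof. by move=> uS; rewrite /contract neq_r // eqxx. Qed.

(** Tightness gives [r] degree 1. An odd set containing [r] is replaced by its complement in
    [r |: S], which is odd too because [#|S| + 1] is even; so every odd cut comes from an odd cut of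
    [A]. *)
Lemma fractional_contract : fractional_matching (r |: S) contract.
Proof.
have [xC x0 xd x1 xodd] := xA.
have yC u v : contract u v = contract v u.
  by rewrite /contract; case: eqP; case: eqP => // _ _.
have cutE (U : {set V}) : U \subset S -> cut contract (r |: S) U = cut x A U.
  move=> sUS; apply: eq_bigr => u uU; have uS := subsetP sUS u uU.
  have -> : (r |: S) :\: U = r |: (S :\: U).
    apply/setP => z; rewrite !inE; case: (eqVneq z r) => [->|//] /=.
    by rewrite andbT; apply: contra rS; apply: (subsetP sUS).
  rewrite big_setU1 /=; last by rewrite !inE (negbTE rS) andbF.
  rewrite contract_out //.
  have -> : \sum_(v in S :\: U) contract u v = \sum_(v in S :\: U) x u v.
    by apply: eq_bigr => v; rewrite inE => /andP[_ vS]; rewrite contract_in.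
  rewrite (@sum_subset_split (A :\: U) (S :\: U)) ?setSD // addrC; congr (_ + _).
  apply: eq_bigl => z; rewrite !inE.
  case zU: (z \in U) => /=; first by rewrite (subsetP sUS).
  by rewrite andbC; case: (z \in S); rewrite ?andbF.
split=> //.
- move=> u v; rewrite /contract; have out0 z : 0 <= out z by apply: sumr_ge0.
  by do 2?case: eqP.
- by move=> u; rewrite /contract; case: eqP.
- move=> u; rewrite in_setU1 big_setU1 //=.
  case/orP => [/eqP->|uS].
    rewrite {1}/contract eqxx add0r -tight /cut; apply: eq_bigr => v vS.
    by rewrite yC contract_out.
  rewrite contract_out // -(x1 u (subsetP sSA u uS)) (sum_subset_split _ sSA) addrC.
  by congr (_ + _); apply: eq_bigr => v vS; rewrite contract_in.
move=> U sUS odd_U.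
have sub (W : {set V}) : W \subset r |: S -> r \notin W -> W \subset S.
  move=> sWS rW; apply/subsetP => z zW; have := subsetP sWS z zW.
  by rewrite !inE => /orP[/eqP zr|//]; rewrite -zr zW in rW.
case: (boolP (r \in U)) => rU; last first.
  have sU := sub U sUS rU.
  by rewrite cutE //; apply: xodd => //; apply: subset_trans sSA.
rewrite -(cutC yC sUS) cutE; last first.
  by apply: sub; rewrite ?subsetDl // inE rU.
apply: xodd; last first.
  have leU := subset_leq_card sUS.
  by rewrite cardsD (setIidPr sUS) oddB // cardsU1 rS add1n /= odd_S odd_U.
apply: subset_trans sSA; apply: sub; rewrite ?subsetDl //.
by rewrite inE rU.
Qed.

Lemma matching_uncontract s m : s \in S -> m s = r ->
  matching_in (r |: S) contract m -> matching_in (S :\ s) x m.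
Proof.
move=> sS ms mP u /setD1P[us uS].
have uA' : u \in r |: S by rewrite in_setU1 uS orbT.
have sA' : s \in r |: S by rewrite in_setU1 sS orbT.
have [muA mmu xmu] := mP u uA'; have [_ mms _] := mP s sA'.
have mur : m u != r.
  by apply/eqP => mur; move: us; rewrite -mmu mur -ms mms eqxx.
have mus : m u != s.
  by apply/eqP => mus; move: rS; rewrite -ms -mus mmu uS.
have muS : m u \in S by move: muA; rewrite in_setU1 (negbTE mur).
by split; rewrite // ?inE ?mus // -contract_in.
Qed.

(* [c s] is the least cost of matching [S :\ s]; giving the contracted edge at [s] the cost
   [- c s] makes every perfect matching of the contracted graph cost at least zero. *)
Lemma contraction_costs w : cheap_matching (r |: S) contract ->
  exists (c : V -> rat) (mm : V -> V -> V),
    (forall s, s \in S -> 0 < out s -> matching_in (S :\ s) x (mm s) /\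
        \sum_(u in S :\ s) w u (mm s u) = c s) /\
    \sum_(s in S) out s * c s <= value S x w.
Proof.
move=> cheap.
have sS' s : s \in S -> s \in r |: S by move=> sS; rewrite in_setU1 sS orbT.
have [_ x0 _ _ _] := xA.
have out0 z : 0 <= out z by apply: sumr_ge0.
have exm s : s \in S -> 0 < out s -> exists m, matching_in (S :\ s) x m.
  move=> sS outs.
  (* With cost -1 on the edge [s r] the fractional value is [- out s < 0], so a cheap matching must
     use that edge, and what remains matches [S :\ s]. *)
  have [m mP] := cheap (fun u v => if (u == s) && (v == r) then -1 else 0).
  have -> : value (r |: S) contract
     (fun u v => if (u == s) && (v == r) then -1 else 0) = - out s.
    rewrite /value (bigD1 s) /= ?sS' // [X in _ + X]big1 ?addr0 => [|u /andP[_ /negbTE us]].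
      rewrite (bigD1 r) /= ?setU11 // !eqxx contract_out // mulrN1 big1 ?addr0 //.
      by move=> v /andP[_ /negbTE ->]; rewrite andbF mulr0.
    by rewrite big1 // => v _; rewrite us mulr0.
  move=> le_out.
  have [ms|nms] := eqVneq (m s) r; first by exists m; apply: matching_uncontract ms mP.
  move: le_out; rewrite big1 ?oppr_ge0 ?leNgt ?outs // => u _.
  by case: eqP => // ->; rewrite (negbTE nms).
have [mm mmP] : exists mm : V -> V -> V, forall s, s \in S -> 0 < out s ->
    matching_in (S :\ s) x (mm s) /\
    forall m', matching_in (S :\ s) x m' ->
      \sum_(u in S :\ s) w u (mm s u) <= \sum_(u in S :\ s) w u (m' u).
  have /fin_all_exists[mm mmP] (s : V) : exists m : V -> V, s \in S -> 0 < out s ->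
    matching_in (S :\ s) x m /\
    forall m', matching_in (S :\ s) x m' ->
      \sum_(u in S :\ s) w u (m u) <= \sum_(u in S :\ s) w u (m' u).
    case: (boolP ((s \in S) && (0 < out s))) => [/andP[sS outs]|no].
      by have [m /(min_matching w)[m' ? ?]] := exm s sS outs; exists m'.
    by exists id => sS outs; rewrite sS outs in no.
  by exists mm.
pose c s := \sum_(u in S :\ s) w u (mm s u).
exists c, mm; split; first by move=> s sS outs; have [] := mmP s sS outs.
have [m mP] := cheap (fun u v => if u == r then 0 else if v == r then - c u else w u v).
have -> : value (r |: S) contract
   (fun u v => if u == r then 0 else if v == r then - c u else w u v) =
   value S x w - \sum_(s in S) out s * c s.
  rewrite /value big_setU1 //= big1 ?add0r => [|v _]; last by rewrite eqxx mulr0.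
  rewrite -sumrB; apply: eq_bigr => s sS; rewrite big_setU1 //= contract_out //.
  rewrite neq_r // eqxx mulrN addrC; congr (_ + _).
  by apply: eq_bigr => v vS; rewrite neq_r // contract_in.
rewrite -subr_ge0 => H; rewrite -subr_ge0; apply: le_trans H _.
rewrite gerBl.
have rA' : r \in r |: S by rewrite setU11.
have [mrA mmr xmr] := mP r rA'.
have mrS : m r \in S.
  by move: mrA; rewrite in_setU1 => /orP[/eqP mr|//]; move: xmr; rewrite mr /contract eqxx ltxx.
rewrite big_setU1 //= eqxx add0r (big_setD1 (m r)) //= neq_r // mmr eqxx.
have mP' := matching_uncontract mrS mmr mP.
rewrite addrC subr_ge0; have outs : 0 < out (m r).
  by rewrite -contract_out // -[X in contract _ X]mmr; have [] := mP _ (sS' _ mrS).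
have [_ /(_ m mP')] := mmP _ mrS outs; rewrite -/(c (m r)) => /le_trans; apply.
rewrite le_eqVlt; apply/orP; left; apply/eqP/eq_bigr => u uS'.
have [muS' _ _] := mP' u uS'.
by move/setD1P: uS' => [_ uS]; move/setD1P: muS' => [_ muS]; rewrite !neq_r.
Qed.

End Contraction.

(** A cut edge [s t] of the support, together with optimal matchings of [S :\ s] and [T :\ t], is a
    perfect matching of [A]. The weights [x s t] of the cut edges sum to 1, and with them the costs
    of these matchings average at most [value A x w], by the estimates for the two contractions. Two
    vertices on each side make both contractions smaller than [A]. *)
Lemma cheap_of_tight_cut A S x w : fractional_matching A x ->
  (forall A' x', #|A'| < #|A| -> fractional_matching A' x' -> cheap_matching A' x')%N ->
  S \subset A -> odd #|S| -> cut x A S = 1 -> (1 < #|S|)%N -> (1 < #|A :\: S|)%N ->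
  exists2 m, matching_in A x m & \sum_(u in A) w u (m u) <= value A x w.
Proof.
move=> xA IH sSA odd_S tightS S1 T1; set T := A :\: S in T1.
have [xC x0 xd x1 xodd] := xA.
have sTA : T \subset A by apply: subsetDl.
have DT : A :\: T = S by rewrite setDDr setDv set0U (setIidPr sSA).
have cardA : (#|S| + #|T| = #|A|)%N by rewrite -(cardsID S A) (setIidPr sSA).
have odd_T : odd #|T|.
  by have := fractional_even xA; rewrite -cardA oddD odd_S /= negbK.
have tightT : cut x A T = 1 by rewrite (cutC xC sSA).
have [r rT] : exists r, r \in T by apply/card_gt0P; apply: ltnW.
have [q qS] : exists q, q \in A :\: T by apply/card_gt0P; rewrite DT ltnW.
have small (U : {set V}) z : (#|U| + 1 < #|A| -> #|z |: U| < #|A|)%N.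
  by move=> lt; rewrite cardsU1; case: (z \in U); rewrite /= ?add0n ?add1n ?addn1 in lt *; lia.
have [|c1 [m1 [/= m1P /= le1]]] := contraction_costs xA rT w.
  by apply: IH; [apply: small; lia|apply: fractional_contract].
have [|c2 [m2 [/= m2P /= le2]]] := contraction_costs xA qS w.
  by apply: IH; [apply: small; lia|apply: fractional_contract].
rewrite DT in m2P le2.
have [] := @weighted_average_le (V * V)%type
    [pred p | (p.1 \in S) && (p.2 \in T)] (fun p => x p.1 p.2)
    (fun p => c1 p.1 + c2 p.2 + (w p.1 p.2 + w p.2 p.1)) (value A x w).
- by move=> p _; apply: x0.
- by rewrite -(pair_big (mem S) (mem T) x).
- rewrite -(pair_big (mem S) (mem T) (fun s t => x s t * (c1 s + c2 t + (w s t + w t s)))) /=.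
  have -> : \sum_(s in S) \sum_(t in T) x s t * (c1 s + c2 t + (w s t + w t s)) =
     \sum_(s in S) (\sum_(t in T) x s t) * c1 s + \sum_(t in T) (\sum_(s in S) x t s) * c2 t
     + (\sum_(s in S) \sum_(t in T) x s t * w s t +
        \sum_(t in T) \sum_(s in S) x t s * w t s).
    under [X in _ = _ + X + _]eq_bigr => t _ do rewrite mulr_suml.
    rewrite [X in _ = _ + X + _]exchange_big [X in _ = _ + (_ + X)]exchange_big -!big_split.
    apply: eq_bigr => s _; rewrite mulr_suml -!big_split.
    by apply: eq_bigr => t _ /=; rewrite (xC t s); ring.
  have -> : value A x w = value S x w + value T x w +
       (\sum_(s in S) \sum_(t in T) x s t * w s t +
        \sum_(t in T) \sum_(s in S) x t s * w t s).
    rewrite /value (sum_subset_split _ sSA) -/T.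
    under eq_bigr => u _ do rewrite (sum_subset_split _ sSA) -/T.
    under [X in _ + X = _]eq_bigr => u _ do rewrite (sum_subset_split _ sSA) -/T.
    by rewrite !big_split /=; ring.
  by rewrite lerD2r; apply: lerD.
move=> [s t] /= [/andP[sS tT] xst le_st].
have TnS u : u \in T -> (u \in S) = false by rewrite inE => /andP[/negbTE].
have neqST u v : u \in S -> v \in T -> (u == v) = false.
  by move=> uS vT; apply/eqP => uv; move: uS; rewrite uv TnS.
have neqTS u v : u \in T -> v \in S -> (u == v) = false.
  by move=> uT vS; rewrite eq_sym neqST.
have outs : 0 < \sum_(t in T) x s t.
  by rewrite (bigD1 t) //= ltr_pwDl // sumr_ge0.
have outt : 0 < \sum_(s in S) x t s.
  by rewrite (bigD1 s) //= ltr_pwDl ?sumr_ge0 // xC.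
have [m1s c1s] := m1P s sS outs; have [m2t c2t] := m2P t tT outt.
pose m u := if u == s then t else if u == t then s else
  if u \in S then m1 s u else m2 t u.
have mS u : u \in S :\ s -> m u = m1 s u.
  by case/setD1P => /negbTE us uS; rewrite /m us uS neqST.
have mT u : u \in T :\ t -> m u = m2 t u.
  by case/setD1P => /negbTE ut uT; rewrite /m ut TnS // neqTS.
have ms : m s = t by rewrite /m eqxx.
have mt : m t = s by rewrite /m eqxx neqTS.
exists m.
  move=> u uA; have sA := subsetP sSA s sS; have tA := subsetP sTA t tT.
  have [->|us] := eqVneq u s; first by rewrite ms mt.
  have [->|ut] := eqVneq u t; first by rewrite mt ms xC.
  case uS: (u \in S).
    have uSs : u \in S :\ s by rewrite !inE us.
    have [muS mmu xmu] := m1s u uSs.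
    rewrite (mS u uSs) (mS _ muS) mmu; split=> //.
    by move/setD1P: muS => [_]; apply: subsetP.
  have uTt : u \in T :\ t by rewrite !inE ut uS.
  have [muT mmu xmu] := m2t u uTt.
  rewrite (mT u uTt) (mT _ muT) mmu; split=> //.
  by move/setD1P: muT => [_]; apply: subsetP.
apply: le_trans le_st; rewrite (sum_subset_split _ sSA) -/T.
have E1 : \sum_(u in S) w u (m u) = w s t + c1 s.
  rewrite (big_setD1 s) //= ms -c1s; congr (_ + _).
  by apply: eq_bigr => u /mS ->.
have E2 : \sum_(u in T) w u (m u) = w t s + c2 t.
  rewrite (big_setD1 t) //= mt -c2t; congr (_ + _).
  by apply: eq_bigr => u /mT ->.
rewrite E1 E2 /=; rewrite le_eqVlt; apply/orP; left; apply/eqP; ring.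
Qed.

Lemma cut_degree A x S : fractional_matching A x -> S \subset A ->
  cut x A S = #|S|%:R - \sum_(u in S) \sum_(v in S) x u v.
Proof.
case=> _ _ _ x1 _ sSA; rewrite /cut -sum1_card natr_sum -sumrB.
apply: eq_bigr => u uS; apply/eqP; rewrite eq_sym subr_eq addrC.
by rewrite -(sum_subset_split _ sSA) x1 // (subsetP sSA).
Qed.

(** * Moving inside the polytope *)

Definition support_pair A x u v := [&& u \in A, v \in A & 0 < x u v].

(** Support degrees of at least 3 yield at least 3/2 [#|A|] support edges, more than there are
    vertices. So the edge-vertex incidence matrix has a nonzero vector in its left kernel, which is
    an edge weighting with sum zero at every vertex. *)
Lemma balanced_direction A x : (forall u v, x u v = x v u) -> (forall u, x u u = 0) ->
  A != set0 -> (forall u, u \in A -> 2 < #|[set v in A | (0 < x u v)%R]|)%N ->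
  exists d, [/\ forall u v, d u v = d v u,
    forall u v, d u v != 0 -> support_pair A x u v,
    forall u, u \in A -> \sum_(v in A) d u v = 0 & exists u v, d u v != 0].
Proof.
move=> xC xd An0 deg3.
pose D := [set p : V * V | support_pair A x p.1 p.2].
(* Each support edge is kept in one of its two orders. *)
pose E := [set p in D | enum_rank p.1 < enum_rank p.2]%N.
have supC u v : support_pair A x u v = support_pair A x v u.
  by rewrite /support_pair xC andbCA.
have cardD : (#|D| = #|E| + #|E|)%N.
  rewrite -(cardsID E D); congr (_ + _)%N.
    by apply: eq_card => p; rewrite !inE andbC; case: (support_pair _ _ _ _); case: (_ < _)%N.
  pose sw (p : V * V) := (p.2, p.1).
  have swK : involutive sw by case.
  rewrite -(card_imset _ (inv_inj swK)); congr #|pred_of_set _|.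
  apply/setP => -[u v]; rewrite -[(u, v)]swK mem_imset; last exact: inv_inj.
  rewrite /sw !inE /= supC; case sup: (support_pair _ _ _ _); rewrite //= andbT -leqNgt ltn_neqAle.
  suff -> : enum_rank u != enum_rank v :> nat by [].
  apply/eqP => /val_inj/enum_rank_inj vu; move: sup; rewrite vu /support_pair xd ltxx.
  by rewrite !andbF.
have EA : (#|A| < #|E|)%N.
  have : (3 * #|A| <= #|D|)%N.
    have -> : (#|D| = \sum_(u in A) #|[set v in A | (0 < x u v)%R]|)%N.
      rewrite -sum1_card.
      under [RHS]eq_bigr => u _ do rewrite -sum1_card.
      rewrite pair_big_dep /=; apply: eq_bigl => -[u v].
      by rewrite !inE /support_pair.
    by rewrite mulnC -sum_nat_const; apply: leq_sum.
  have : (0 < #|A|)%N by rewrite card_gt0.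
  by rewrite cardD; lia.
pose e (i : 'I_#|E|) : V * V := enum_val i.
have eE i : [/\ (e i).1 \in A, (e i).2 \in A, 0 < x (e i).1 (e i).2
   & (enum_rank (e i).1 < enum_rank (e i).2)%N].
  by have := enum_valP i; rewrite !inE => /andP[/and3P[? ? ?] ?].
pose B : 'M[rat]_(#|E|, #|A|) :=
  \matrix_(i, j) (((e i).1 == enum_val j)%:R + ((e i).2 == enum_val j)%:R).
have : kermx B != 0.
  by rewrite -mxrank_eq0 mxrank_ker subn_eq0 -ltnNge (leq_ltn_trans (rank_leq_col B)).
case/rowV0Pn => k /sub_kermxP kB k0.
pose d u v := \sum_i k 0 i * ((e i == (u, v))%:R + (e i == (v, u))%:R).
exists d; split.
- by move=> u v; apply: eq_bigr => i _; rewrite addrC.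
- move=> u v; apply: contraR => sup; apply/eqP; rewrite /d big1 // => i _.
  have [e1 e2 xe _] := eE i.
  have ne : (e i == (u, v)) = false.
    by apply: contraNF sup => /eqP eq_e; rewrite eq_e in e1 e2 xe; rewrite /support_pair e1 e2.
  have ne' : (e i == (v, u)) = false.
    by apply: contraNF sup => /eqP eq_e; rewrite eq_e in e1 e2 xe; rewrite supC /support_pair e1 e2.
  by rewrite ne ne' addr0 mulr0.
- move=> u uA; rewrite exchange_big /=.
  have /matrixP/(_ 0 (enum_rank_in uA u)) := kB; rewrite !mxE => kBu.
  rewrite -[RHS]kBu; apply: eq_bigr => i _.
  rewrite -mulr_sumr mxE enum_rankK_in // big_split /=; congr (_ * (_ + _)).
    rewrite (bigD1 (e i).2) /=; last by have [] := eE i.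
    rewrite {1}[e i]surjective_pairing xpair_eqE eqxx andbT big1 ?addr0 //.
    move=> v /andP[_ /negbTE vn].
    by rewrite {1}[e i]surjective_pairing xpair_eqE eq_sym [_ == v]eq_sym vn andbF.
  rewrite (bigD1 (e i).1) /=; last by have [] := eE i.
  rewrite {1}[e i]surjective_pairing xpair_eqE eqxx /= big1 ?addr0 //.
  by move=> v /andP[_ /negbTE vn]; rewrite {1}[e i]surjective_pairing xpair_eqE [_ == v]eq_sym vn.
case/rV0Pn: k0 => i ki.
exists (e i).1, (e i).2; rewrite /d (bigD1 i) //= big1 ?addr0 => [|j ji].
  rewrite -surjective_pairing eqxx; case: (e i =P _) => [ei|_]; last by rewrite addr0 mulr1.
  have [_ _ _] := eE i; have -> : (e i).1 = (e i).2 by rewrite {1}ei.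
  by rewrite ltnn.
rewrite -surjective_pairing (inj_eq enum_val_inj) (negbTE ji) add0r.
case: (e j =P _) => [ej|_]; last by rewrite mulr0.
have [_ _ _ lt_i] := eE i; have [_ _ _] := eE j.
by rewrite ej /= ltnNge (ltnW lt_i).
Qed.

Definition nontrivial_odd A S :=
  [&& S \subset A, odd #|S|, (1 < #|S|)%N & (1 < #|A :\: S|)%N].

(* A vertex [q] all of whose neighbours are among [p], [r] yields the tight cut [{p, q, r}]. *)
Lemma three_neighbours A x : fractional_matching A x -> (4 < #|A|)%N ->
  (forall S, nontrivial_odd A S -> 1 < cut x A S) ->
  forall q, q \in A -> (2 < #|[set v in A | (0 < x q v)%R]|)%N.
Proof.
move=> xA A4 notight q qA; have [xC x0 xd x1 xodd] := xA.
rewrite ltnNge; apply/negP => le2; set N := [set v in A | _] in le2.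
have /existsP[p /existsP[r /and5P[pA rA pq rq /andP[rp sN]]]] :
  [exists p, exists r, [&& p \in A, r \in A, p != q, r != q & (r != p) && (N \subset [set p; r])]].
  have qN : q \notin N by rewrite inE xd ltxx andbF.
  have sNA : N \subset A by apply/subsetP => z; rewrite inE => /andP[].
  have ex (B : {set V}) : (#|B| < #|A|)%N -> exists2 z, z \in A & z \notin B.
    by move=> lt; apply/subsetPn; apply: contraL lt => /subset_leq_card; rewrite -leqNgt.
  (* When [q] has fewer than two neighbours, [p] and [r] are completed by arbitrary vertices. *)
  have [pz|/set0Pn[p pN]] := eqVneq N set0.
    have [p pA pn] := ex [set q] ltac:(by rewrite cards1; lia).
    have [r rA rn] := ex [set q; p] ltac:(by rewrite cards2; case: eqP => /=; lia).
    apply/existsP; exists p; apply/existsP; exists r.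
    move: pn rn; rewrite pA rA !inE negb_or => -> /andP[-> ->].
    by rewrite pz sub0set.
  have pA := subsetP sNA p pN.
  have pq : p != q by apply: contraNneq qN => <-.
  have [pz|/set0Pn[r]] := eqVneq (N :\ p) set0.
    have [r rA rn] := ex [set q; p] ltac:(by rewrite cards2; case: eqP => /=; lia).
    apply/existsP; exists p; apply/existsP; exists r.
    move: rn; rewrite pA rA !inE negb_or pq => /andP[-> ->] /=.
    apply/subsetP => z zN; rewrite !inE; case: eqP => //= /eqP zp.
    have : z \in N :\ p by apply/setD1P.
    by rewrite pz inE.
  rewrite !inE => /andP[rp /andP[rA xr]].
  apply/existsP; exists p; apply/existsP; exists r.
  rewrite pA rA pq rp /=; apply/andP; split.
    by apply: contraNneq qN => <-; rewrite inE rA.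
  have rN : r \in N by rewrite inE rA.
  suff -> : N = [set p; r] by [].
  apply/eqP; rewrite eq_sym eqEcard cards2 eq_sym rp le2 andbT.
  by apply/subsetP => z; rewrite !inE => /orP[] /eqP->; rewrite ?inE ?rA //; move: pN; rewrite inE.
pose S := q |: [set p; r].
have card3 : #|S| = 3%N.
  by rewrite cardsU1 cards2 !inE negb_or ![q == _]eq_sym pq rq eq_sym rp.
have sSA : S \subset A.
  by apply/subsetP => z; rewrite !inE => /or3P[]/eqP->.
have cardT : (#|A :\: S| + 3 = #|A|)%N.
  by rewrite -card3 addnC -(cardsID S A) (setIidPr sSA).
have nS : nontrivial_odd A S.
  rewrite /nontrivial_odd sSA card3 /=; move: (fractional_even xA); rewrite -cardT.
  by case: #|A :\: S| cardT => [|[|n]] //=; lia.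
have xq : x q p + x q r = 1.
  rewrite -(x1 q qA) (bigD1 p) //= (bigD1 r) ?rA //= addrA big1 ?addr0 // => z.
  case/andP => /andP[zA zp] zr; apply/eqP; rewrite eq_le x0 andbT leNgt.
  apply: contra zp => xz; have : z \in N by rewrite inE zA.
  by move/(subsetP sN); rewrite !inE (negbTE zr) orbF.
(* The cut has value [3 - 2 * (x q p + x q r + x p r)], that is [1 - 2 * x p r]. *)
have := notight S nS; rewrite (cut_degree xA sSA) card3.
have qn : q \notin [set p; r] by rewrite !inE negb_or ![q == _]eq_sym pq.
have sumS F : \sum_(u in S) F u = F q + (F p + F r) :> rat.
  by rewrite /S big_setU1 //= big_setU1 ?big_set1 // inE eq_sym.
rewrite !sumS !xd (xC p q) (xC r q) (xC r p).
have := x0 p r; move: xq => /= xq; lra.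
Qed.

Lemma cutD A x d e S : cut (fun u v => x u v + e * d u v) A S = cut x A S + e * cut d A S.
Proof.
rewrite /cut mulr_sumr -big_split; apply: eq_bigr => u _.
by rewrite mulr_sumr -big_split.
Qed.

Lemma valueD A x d e w :
  value A (fun u v => x u v + e * d u v) w = value A x w + e * value A d w.
Proof.
rewrite /value mulr_sumr -big_split; apply: eq_bigr => u _.
by rewrite mulr_sumr -big_split; apply: eq_bigr => v _ /=; ring.
Qed.

(** All positivity constraints on the support and all nontrivial odd cuts are slack at [x]; the move
    stops when the first of them becomes an equality. Odd cuts with a single vertex on one side stay
    equal to 1, because [d] does not change degrees. *)
Lemma move_to_boundary A x d w : fractional_matching A x ->
  (forall S, nontrivial_odd A S -> 1 < cut x A S) ->
  (forall u v, d u v = d v u) -> (forall u v, d u v != 0 -> support_pair A x u v) ->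
  (forall u, u \in A -> \sum_(v in A) d u v = 0) ->
  (exists u v, d u v < 0) -> value A d w <= 0 ->
  exists x', [/\ fractional_matching A x', value A x' w <= value A x w,
    forall u v, 0 < x' u v -> 0 < x u v &
    (exists u v, support_pair A x u v /\ x' u v = 0) \/
    (exists2 S, nontrivial_odd A S & cut x' A S = 1)].
Proof.
move=> xA notight dC dsup d0 [u0 [v0 d00]] dw; have [xC x0 xd x1 xodd] := xA.
pose P (i : V * V + {set V}) := match i with
  | inl p => support_pair A x p.1 p.2 | inr T => nontrivial_odd A T end.
pose g (i : V * V + {set V}) := match i with
  | inl p => x p.1 p.2 | inr T => cut x A T - 1 end.
pose h (i : V * V + {set V}) := match i with
  | inl p => d p.1 p.2 | inr T => cut d A T end.
have [||e e0 [ge0 [i Pi gi]]] := @first_blocking _ P g h.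
- by case=> [p /and3P[]//|S /notight]; rewrite subr_gt0.
- by exists (inl (u0, v0)) => //=; apply: dsup; rewrite lt_eqF.
pose y u v := x u v + e * d u v.
have yC u v : y u v = y v u by rewrite /y xC dC.
have dz u v : ~~ support_pair A x u v -> d u v = 0.
  by move=> ns; apply/eqP; apply: contraR ns; apply: dsup.
have y1 u : u \in A -> \sum_(v in A) y u v = 1.
  by move=> uA; rewrite big_split -mulr_sumr d0 //= mulr0 addr0 x1.
have yd u : y u u = 0.
  by rewrite /y dz ?xd ?mulr0 ?addr0 // /support_pair xd ltxx !andbF.
have cut1 u : u \in A -> cut y A [set u] = 1.
  move=> uA; rewrite /cut big_set1 -(y1 u uA) (@sum_subset_split A [set u]) ?sub1set //.
  by rewrite big_set1 yd add0r.
exists y; split.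
- split=> //.
    move=> u v; rewrite /y; case: (boolP (support_pair A x u v)) => [sup|/dz->].
      exact: (ge0 (inl (u, v)) sup).
    by rewrite mulr0 addr0.
  move=> S sSA odd_S; have [S1|nS1] := boolP (1 < #|S|)%N; last first.
    have /cards1P[u Su] : #|S| == 1%N by case: #|S| odd_S nS1 => [|[]].
    by rewrite Su cut1 // -sub1set -Su.
  have [T1|nT1] := boolP (1 < #|A :\: S|)%N; last first.
    have /cards1P[u Tu] : #|A :\: S| == 1%N.
      have := fractional_even xA; rewrite -(cardsID S A) (setIidPr sSA) oddD odd_S /= negbK.
      by case: #|A :\: S| nT1 => [|[]].
    rewrite -(cutC yC sSA) Tu cut1 // -sub1set -Tu; exact: subsetDl.
  have nS : nontrivial_odd A S by rewrite /nontrivial_odd sSA odd_S S1.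
  by rewrite cutD; have := ge0 (inr S) nS => /=; rewrite addrAC subr_ge0.
- by rewrite valueD gerDl mulr_ge0_le0.
- move=> u v; case: (boolP (support_pair A x u v)) => [/and3P[]//|/dz].
  by rewrite /y => ->; rewrite mulr0 addr0.
case: i Pi gi => [[u v]|S] /= Pi gi; first by left; exists u, v.
right; exists S => //; rewrite cutD; apply/eqP; rewrite -subr_eq0 addrAC; exact/eqP.
Qed.

(** On four vertices the degree equations give disjoint edges equal weight, so [x] is a convex
    combination of the three perfect matchings. *)
Lemma cheap_small A x w : fractional_matching A x -> (#|A| <= 4)%N ->
  exists2 m, matching_in A x m & \sum_(u in A) w u (m u) <= value A x w.
Proof.
move=> xA A4; have [xC x0 xd x1 _] := xA.
have eA (s : seq V) : enum A = s -> (forall F, \sum_(u in A) F u = \sum_(u <- s) F u :> rat).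
  by move=> <- F; rewrite big_enum.
have mA (s : seq V) : enum A = s -> (A =i s) /\ uniq s.
  by move=> <-; split=> [z|]; rewrite ?mem_enum ?enum_uniq.
have := fractional_even xA; rewrite cardE in A4 *.
case En : (enum A) A4 => [|a [|b [|c [|d [|? ?]]]]] //= _ _.
- have [A0 _] := mA _ En; exists id => [u|]; first by rewrite A0.
  by rewrite /value !(eA _ En) !big_nil.
- have [Am /and3P[]] := mA _ En; rewrite inE => ab _ _.
  have xab : x a b = 1.
    have := x1 a; rewrite Am !inE eqxx (eA _ En) !big_cons big_nil xd => /(_ isT).
    by rewrite add0r addr0.
  have ba : (b == a) = false by rewrite eq_sym (negbTE ab).
  exists (fun u => if u == a then b else a).
    move=> u; rewrite Am !inE => /orP[] /eqP->; rewrite ?eqxx ?ba !Am !inE !eqxx ?orbT;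
    by rewrite ?ba ?eqxx ?(xC b a) ?xab.
  rewrite /value !(eA _ En) !big_cons !big_nil !(eA _ En) !big_cons !big_nil eqxx ba.
  by rewrite !xd (xC b a) xab; lra.
have [Am] := mA _ En; rewrite /= !inE !negb_or => /and4P[/and3P[ab ac ad] /andP[bc bd] cd _].
have row u : u \in [:: a; b; c; d] -> x u a + (x u b + (x u c + x u d)) = 1.
  by rewrite -Am => uA; rewrite -(x1 u uA) (eA _ En) !big_cons big_nil addr0.
have ra := row a; have rb := row b; have rc := row c; have rd := row d.
rewrite !inE !eqxx ?orbT !xd (xC b a) (xC c a) (xC d a) (xC c b) (xC d b) (xC d c) /= in ra rb rc rd.
have {}ra := ra isT; have {}rb := rb isT; have {}rc := rc isT; have {}rd := rd isT.
have xcd : x c d = x a b by lra.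
have xbd : x b d = x a c by lra.
have xbc : x b c = x a d by lra.
pose v p q r s := w p q + w q p + (w r s + w s r).
have pair p q r s : perm_eq [:: a; b; c; d] [:: p; q; r; s] -> 0 < x p q -> 0 < x r s ->
    v p q r s <= value A x w ->
    exists2 m, matching_in A x m & \sum_(u in A) w u (m u) <= value A x w.
  move=> perm xpq xrs le_v.
  have Am' : A =i [:: p; q; r; s] by move=> z; rewrite Am (perm_mem perm).
  have : uniq [:: p; q; r; s] by rewrite -(perm_uniq perm); have [] := mA _ En.
  rewrite /= !inE !negb_or => /and4P[/and3P[pq pr ps] /andP[qr qs] rs _].
  pose m u := if u == p then q else if u == q then p else if u == r then s else r.
  have mp : m p = q by rewrite /m eqxx.
  have mq : m q = p by rewrite /m eqxx eq_sym (negbTE pq).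
  have mr : m r = s by rewrite /m eqxx ![r == _]eq_sym (negbTE pr) (negbTE qr).
  have ms : m s = r by rewrite /m ![s == _]eq_sym (negbTE ps) (negbTE qs) (negbTE rs).
  exists m.
    move=> u; rewrite Am' !inE => /or4P[] /eqP->;
    by rewrite ?mp ?mq ?mr ?ms ?mp ?mq ?mr ?ms Am' !inE !eqxx ?orbT; split=> //; rewrite xC.
  rewrite (eA _ En) (perm_big _ perm) !big_cons big_nil mp mq mr ms /=.
  by apply: le_trans le_v; rewrite /v; lra.
have avg : value A x w = x a b * v a b c d + x a c * v a c b d + x a d * v a d b c.
  rewrite /value (eA _ En) !big_cons big_nil !(eA _ En) !big_cons !big_nil !xd /v.
  by rewrite (xC b a) (xC c a) (xC d a) (xC c b) (xC d b) (xC d c) xcd xbd xbc; ring.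
have [] := @weighted_average_le 'I_3 predT (fun i => [:: x a b; x a c; x a d]`_i)
  (fun i => [:: v a b c d; v a c b d; v a d b c]`_i) (value A x w).
- by case=> [[|[|[|i]]] Hi] _ /=.
- by rewrite !big_ord_recl big_ord0 /= addr0; lra.
- by rewrite !big_ord_recl big_ord0 /= addr0 avg addrA.
case=> [[|[|[|//]]] _] /= [_ xpos le_v].
- by apply: (pair a b c d) => //; rewrite xcd.
- apply: (pair a c b d) => //; last by rewrite xbd.
  by rewrite perm_cons (perm_catCA [:: b] [:: c] [:: d]).
- apply: (pair a d b c) => //; last by rewrite xbc.
  by rewrite perm_cons (perm_catC [:: b; c] [:: d]).
Qed.

(* Edmonds' theorem: move [x] in a balanced direction that does not increase the cost until an
   edge vanishes or an odd cut becomes tight, then contract either side of the tight cut. *)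
Theorem fractional_matching_cheap A x : fractional_matching A x -> cheap_matching A x.
Proof.
have [n] := ubnP #|A|; elim: n A x => // n IHn A x; rewrite ltnS => leAn xA w.
have {}IHn A' x' : (#|A'| < #|A|)%N -> fractional_matching A' x' -> cheap_matching A' x'.
  by move=> lt; apply: IHn; apply: leq_trans leAn.
(* Inner induction on the support, for moves that make an edge vanish. *)
have [k] := ubnP #|[set p : V * V | support_pair A x p.1 p.2]|.
elim: k x xA => // k IHk x xA; rewrite ltnS => lek.
have [A4|A4] := leqP #|A| 4; first exact: cheap_small.
have tight_case x' S : fractional_matching A x' -> nontrivial_odd A S -> cut x' A S = 1 ->
    exists2 m, matching_in A x' m & \sum_(u in A) w u (m u) <= value A x' w.
  move=> x'A /and4P[sSA oddS S1 T1] cutS.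
  exact: (cheap_of_tight_cut (S := S)).
case: (pickP (fun S => nontrivial_odd A S && (cut x A S == 1))) => [S /andP[nS /eqP]|no].
  exact: tight_case.
have notight S : nontrivial_odd A S -> 1 < cut x A S.
  move=> nS; have := no S; rewrite nS /= => /negbT ne; rewrite lt_neqAle eq_sym ne /=.
  by have [_ _ _ _ xodd] := xA; move/and4P: nS => [sSA oddS _ _]; apply: xodd.
have [xC x0 xd x1 xodd] := xA.
have An0 : A != set0 by apply: contraTneq A4 => ->; rewrite cards0.
have [d [dC dsup d0 [u0 [v0 duv]]]] :=
  balanced_direction xC xd An0 (three_neighbours xA A4 notight).
have [d' [dC' dsup' d0' [u1 [v1 duv']] dw']] : exists d', [/\ forall u v, d' u v = d' v u,
    forall u v, d' u v != 0 -> support_pair A x u v,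
    forall u, u \in A -> \sum_(v in A) d' u v = 0, exists u v, d' u v != 0
    & value A d' w <= 0].
  have [dw|/ltW dw] := leP (value A d w) 0.
    by exists d; split=> //; exists u0, v0.
  exists (fun u v => - d u v); split.
  - by move=> u v; rewrite dC.
  - by move=> u v; rewrite oppr_eq0; apply: dsup.
  - by move=> u uA; rewrite sumrN d0 ?oppr0.
  - by exists u0, v0; rewrite oppr_eq0.
  rewrite -oppr_ge0 /value -sumrN; apply: le_trans dw _; rewrite le_eqVlt; apply/orP; left.
  apply/eqP/eq_bigr => u _; rewrite -sumrN; apply: eq_bigr => v _; ring.
(* The row of a nonzero entry has sum zero and so a negative entry; hence the move has to stop. *)
have neg : exists u v, d' u v < 0.
  have /and3P[u1A v1A _] := dsup' _ _ duv'.
  case: (pickP (fun v => d' u1 v < 0)) => [v dv|nov]; first by exists u1, v.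
  have := d0' u1 u1A; move/eqP; rewrite psumr_eq0 => [/allP/(_ v1)|v _]; last first.
    by rewrite leNgt nov.
  by rewrite mem_index_enum v1A (negbTE duv') => /(_ isT).
have [x' [x'A le_x' pos]] := move_to_boundary xA notight dC' dsup' d0' neg dw'.
have back m : matching_in A x' m -> matching_in A x m.
  by move=> mP u uA; have [? ? /pos] := mP u uA.
case=> [[u [v [sup x'uv]]]|[S nS cutS]]; last first.
  have [m mP le_m] := tight_case _ S x'A nS cutS.
  by exists m; [apply: back|apply: le_trans le_m le_x'].
have [|m mP le_m] := IHk x' x'A; last first.
  by exists m; [apply: back|apply: le_trans le_m le_x'].
apply: leq_trans lek; apply/proper_card/properP; split.
  by apply/subsetP => p; rewrite !inE => /and3P[p1 p2 /pos]; rewrite /support_pair p1 p2.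
exists (u, v); rewrite !inE //=; rewrite /support_pair x'uv ltxx !andbF //.
Qed.

End Polytope.

(** * Edge cuts *)

Section Cuts.
Variable G : sgraph.
Implicit Types (A B S : {set G}) (x y z : G).

Definition degree_in A x : nat := \sum_(y in A) adj x y.
(** Twice the number of edges inside [A]. *)
Definition inner_degree A : nat := \sum_(x in A) degree_in A x.
Definition boundary S : nat := \sum_(x in S) degree_in (~: S) x.

Lemma sum_boolE (A : {set G}) (P : pred G) : \sum_(y in A) P y = #|[set y in A | P y]|.
Proof.
rewrite -sum1_card big_mkcond [RHS]big_mkcond /=; apply: eq_bigr => y _.
by rewrite inE; case: (y \in A) => //=; case: (P y).
Qed.

Lemma inner_degreeD1 A x : x \in A ->
  inner_degree A = inner_degree (A :\ x) + (degree_in A x).*2.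
Proof.
move=> xA; rewrite /inner_degree (big_setD1 x) //= -addnn addnA addnC; congr (_ + _).
rewrite (eq_bigr (fun u => adj x u + degree_in (A :\ x) u)); last first.
  by move=> u _; rewrite /degree_in (big_setD1 x) //= adj_sym.
rewrite big_split /= addnC; congr (_ + _).
by rewrite /degree_in [RHS](big_setD1 x) //= adj_irr.
Qed.

Lemma inner_degree0 : inner_degree set0 = 0.
Proof. exact: big_set0. Qed.

Lemma inner_degree_even A : ~~ odd (inner_degree A).
Proof.
have [n] := ubnP #|A|; elim: n A => // n IHn A ltn.
have [->|/set0Pn[x xA]] := eqVneq A set0; first by rewrite inner_degree0.
rewrite (inner_degreeD1 xA) oddD odd_double addbF; apply: IHn.
by move: ltn; rewrite (cardsD1 x) xA.
Qed.

Lemma contains_circuitS A B : A \subset B -> contains_circuit A -> contains_circuit B.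
Proof. by move=> sAB [c cP cA]; exists c => // x /cA; apply: (subsetP sAB). Qed.

(** A path in [A] is prolonged at its first vertex by a neighbour other than its second vertex. It
    cannot outgrow [A], so eventually that neighbour already lies on the path and closes a
    circuit. *)
Lemma circuit_of_min_degree A : A != set0 ->
  (forall x, x \in A -> 1 < degree_in A x) -> contains_circuit A.
Proof.
move=> An0 deg2.
have nbr x y : x \in A -> exists z, [/\ z \in A, adj x z & z != y].
  move=> xA; have := deg2 x xA; rewrite /degree_in sum_boolE => lt.
  have : ~~ ([set z in A | adj x z] \subset [set y]).
    by apply: contraL lt => /subset_leq_card; rewrite cards1 -leqNgt.
  by case/subsetPn => z; rewrite !inE => /andP[zA xz] zy; exists z.
suff grow n : contains_circuit A \/
    exists x p, [/\ path (@adj G) x p, uniq (x :: p), {subset x :: p <= A} & size p = n].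
  have [//|[x [p [_ uniq_p sub_p size_p]]]] := grow #|A|.
  have sub' : {subset x :: p <= enum A} by move=> z /sub_p; rewrite mem_enum.
  by have := uniq_leq_size uniq_p sub'; rewrite -cardE /= size_p ltnn.
elim: n => [|n [|[x [p [path_p uniq_p sub_p size_p]]]]]; [|by left|].
  have /set0Pn[x xA] := An0; right; exists x, [::]; split=> // z.
  by rewrite inE => /eqP->.
(* [head x p] is the second vertex of the path; on a one-vertex path it defaults to [x], which is
   not its own neighbour. *)
have [z [zA xz zh]] := nbr x (head x p) (sub_p x (mem_head _ _)).
have [zp|zp] := boolP (z \in x :: p); last first.
  right; exists z, (x :: p); split=> /=.
  - by rewrite adj_sym xz.
  - by rewrite zp.
  - by move=> u; rewrite inE => /orP[/eqP->|/sub_p].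
  by rewrite size_p.
left; move: zp; rewrite inE => /orP[/eqP zx|zp]; first by rewrite zx adj_irr in xz.
case/path.splitP: zp zh path_p uniq_p sub_p => p1 p2 {size_p} zh.
rewrite cat_path /= mem_cat negb_or => /andP[path1 _] uniq1 sub1.
exists (x :: rcons p1 z); last first.
  by move=> u; rewrite inE => up; apply: sub1; rewrite inE mem_cat; case/orP: up => ->; rewrite ?orbT.
rewrite /circuit /ucycleb /= rcons_path path1 last_rcons adj_sym xz /= size_rcons.
move: uniq1; rewrite cat_uniq => /andP[/andP[-> _] /andP[-> _]] /=.
by case: p1 zh {path1 sub1} => //=; rewrite eqxx.
Qed.

(** Deleting a vertex of degree at most 1 loses at most one edge and keeps the average degree at
    least 2; when no such vertex is left, the previous lemma applies. *)
Lemma circuit_of_average_degree A : A != set0 -> 2 * #|A| <= inner_degree A -> contains_circuit A.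
Proof.
have [n] := ubnP #|A|; elim: n A => // n IHn A ltn An0 dense.
case: (pickP (fun x => (x \in A) && (degree_in A x <= 1))) => [x /andP[xA degx]|nox]; last first.
  by apply: circuit_of_min_degree => // x xA; have := nox x; rewrite xA /= ltnNge => ->.
move: ltn dense; rewrite (inner_degreeD1 xA) (cardsD1 x) xA /= add1n => ltn dense.
apply: (contains_circuitS (A := A :\ x)); first exact: subsetDl.
apply: IHn => //; last by lia.
apply: contraTneq dense => A0.
move: degx; rewrite /degree_in (big_setD1 x) //= A0 big_set0 adj_irr cards0 inner_degree0 //=.
Qed.

Lemma boundaryC S : boundary (~: S) = boundary S.
Proof.
rewrite /boundary /degree_in setCK exchange_big; apply: eq_bigr => x _.
by apply: eq_bigr => y _; rewrite adj_sym.
Qed.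

(** * Cuts of cubic graphs *)

Section Cubic.
Hypothesis cubic : regular G 3.

Lemma boundaryE A : inner_degree A + boundary A = 3 * #|A|.
Proof.
rewrite /inner_degree /boundary -big_split mulnC -sum_nat_const; apply: eq_bigr => x _ /=.
rewrite -(cubic x) /degree_in !sum_boolE -cardsUI [_ :&: _](_ : _ = set0) ?cards0 ?addn0.
  by congr #|pred_of_set _|; apply/setP => y; rewrite !inE; case: (y \in A); rewrite ?orbF.
by apply/setP => y; rewrite !inE; case: (y \in A); rewrite ?andbF.
Qed.

Lemma circuit_of_boundary A : A != set0 -> boundary A <= #|A| -> contains_circuit A.
Proof.
move=> An0 leb; apply: circuit_of_average_degree => //.
by have := boundaryE A; lia.
Qed.

Lemma boundary_odd S : odd (boundary S) = odd #|S|.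
Proof.
have := congr1 odd (boundaryE S); rewrite oddD (negbTE (inner_degree_even S)) /= => ->.
by rewrite oddM.
Qed.

Lemma even_order : ~~ odd #|G|.
Proof.
have := boundary_odd setT; rewrite cardsT => <-.
by rewrite -boundaryC setCT /boundary big_set0.
Qed.

Hypothesis cyc4 : cyclically_edge_connected 4 G.

(** The size conditions put a circuit on each side. Were there at most three edges leaving [S],
    deleting them would keep both circuits and leave no edge out of [S], so the circuits would lie
    in different components. *)
Lemma boundary_ge4 S : S != set0 -> S != setT -> boundary S <= #|S| ->
  boundary S <= #|~: S| -> 3 < boundary S.
Proof.
move=> Sn0 SnT le1 le2.
have [c1 c1P c1S] := circuit_of_boundary Sn0 le1.
have [c2 c2P c2S] : contains_circuit (~: S).
  apply: circuit_of_boundary; rewrite ?boundaryC //.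
  by apply: contraNneq SnT => SC; rewrite -[S]setCK SC setC0.
rewrite ltnNge; apply/negP => le3.
pose F := [set [set p.1; p.2] | p : G * G & [&& adj p.1 p.2, p.1 \in S & p.2 \notin S]].
have sFE : F \subset edges G.
  by apply/subsetP => _ /imsetP[p +->]; rewrite inE => /and3P[? _ _]; apply: imset_f; rewrite inE.
have cardF : #|F| < 4.
  rewrite ltnS; apply: leq_trans le3; apply: leq_trans (leq_imset_card _ _) _.
  rewrite /boundary; under eq_bigr => x _ do rewrite /degree_in sum_boolE -sum1_card.
  rewrite pair_big_dep /= -sum1_card; apply: eq_leq; apply: eq_bigl => -[x y].
  by rewrite !inE /= andbC -andbA andbC -andbA [(_ \notin _) && _]andbC.
have crossF x y : adj x y -> (x \in S) != (y \in S) -> [set x; y] \in F.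
  move=> xy; case xS: (x \in S); case yS: (y \in S) => // _.
    by apply/imsetP; exists (x, y); rewrite ?inE /= ?xy ?xS ?yS.
  by rewrite setUC; apply/imsetP; exists (y, x); rewrite ?inE /= 1?adj_sym ?xy ?xS ?yS.
have inF x y : [set x; y] \in F -> (x \in S) != (y \in S).
  case/imsetP => -[a b]; rewrite inE /= => /and3P[_ aS bS] eq_xy.
  have : (a \in [set x; y]) && (b \in [set x; y]) by rewrite eq_xy !inE !eqxx orbT.
  rewrite !inE => /andP[/orP[] /eqP ax /orP[] /eqP bx]; move: aS bS; rewrite ax bx;
  by case: (x \in S); case: (y \in S).
pose H := delete_edges F.
have circH (c : seq G) (b : bool) : circuit c -> (forall x, x \in c -> (x \in S) = b) -> @circuit H c.
  case/andP => c3 /andP[cyc uc] cb; rewrite /circuit c3 /ucycleb uc andbT /=.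
  apply: (sub_in_cycle (P := fun x => (x \in S) == b)) cyc; last first.
    by apply/allP => x /cb ->.
  move=> x y /eqP xb /eqP yb xy; rewrite /= /spanning_adj xy inE.
  by apply/negP => /inF; rewrite xb yb eqxx.
have closedS : closed (@adj H) (mem S).
  move=> x y; rewrite /= /spanning_adj => /andP[xy]; rewrite inE => nF.
  by apply/eqP; apply: contraNT nF; apply: crossF.
pose comp (x : G) : {set H} := [set y in [set: H] | connect (@adj H) x y].
have comp_in x : comp x \in components H by apply: imset_f.
have head_in (c : seq G) : circuit c -> exists x, x \in c.
  by case: c => [//|x c _]; exists x; apply: mem_head.
have circ_comp (c : seq G) x : @circuit H c -> x \in c -> contains_circuit (comp x).
  move=> cP xc; exists c => // y yc; rewrite !inE /=.
  by apply: (connect_cycle (p := c)) => //; case/andP: cP => _ /andP[].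
have [x1 x1c] := head_in c1 c1P; have [x2 x2c] := head_in c2 c2P.
apply: (cyc4 sFE cardF); exists (comp x1), (comp x2); split=> //.
- apply/eqP => eq12; have : x2 \in comp x1 by rewrite eq12 !inE connect0.
  rewrite !inE => /(closed_connect closedS) e12.
  by have := c2S x2 x2c; rewrite inE -[x2 \in S]e12 [X in ~~ X](c1S x1 x1c).
- by apply: (circ_comp c1) => //; apply: (circH c1 true) => // x /c1S.
apply: (circ_comp c2) => //; apply: (circH c2 false) => // x /c2S.
by rewrite inE => /negbTE.
Qed.

(** By parity only the value 1 has to be excluded. Both sides are nonempty, since [#|G|] is even,
    and that is enough for [boundary_ge4] when a single edge leaves. *)
Lemma odd_boundary_ge3 S : odd #|S| -> 2 < boundary S.
Proof.
move=> oddS; have := boundary_odd S; rewrite oddS => odd_b.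
rewrite ltnNge; apply/negP => le2; 
have b1 : boundary S = 1 by move: odd_b le2; case: boundary => [|[|[]]].
have Sn0 : S != set0 by apply: contraTneq oddS => ->; rewrite cards0.
have oddC : odd #|~: S|.
  by have := even_order; rewrite -(cardsC S) oddD oddS /= negbK.
have SnT : S != setT.
  by apply: contraTneq oddC => ->; rewrite setCT cards0.
by have := boundary_ge4 Sn0 SnT; rewrite b1 => /(_ (odd_gt0 oddS) (odd_gt0 oddC)).
Qed.

End Cubic.
End Cuts.

(** * Matchings meeting few closed 5-walks *)

Section Girth.
Variable G : sgraph.
Hypothesis girth5 : girth_is G 5.

Lemma no_triangle (x y z : G) : adj x y -> adj y z -> adj x z -> False.
Proof.
move=> xy yz xz; have [_ /(_ [:: x; y; z])] := girth5; rewrite /circuit /ucycleb /=.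
rewrite xy yz (adj_sym z x) xz !inE !andbT /=.
case: (eqVneq x y) => [e|_]; first by rewrite e adj_irr in xy.
case: (eqVneq x z) => [e|_]; first by rewrite e adj_irr in xz.
by case: (eqVneq y z) => [e|_] //=; [rewrite e adj_irr in yz|move/(_ isT)].
Qed.

Lemma no_square (x y z w : G) : adj x y -> adj y z -> adj z w -> adj w x ->
  x != z -> y != w -> False.
Proof.
move=> xy yz zw wx nxz nyw; have [_ /(_ [:: x; y; z; w])] := girth5; rewrite /circuit /ucycleb /=.
rewrite xy yz zw wx !inE !andbT /= !negb_or nxz nyw /=.
case: (eqVneq x y) => [e|_]; first by rewrite e adj_irr in xy.
case: (eqVneq x w) => [e|_]; first by rewrite e adj_irr in wx.
case: (eqVneq y z) => [e|_]; first by rewrite e adj_irr in yz.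
by case: (eqVneq z w) => [e|_] //=; [rewrite e adj_irr in zw|move/(_ isT)].
Qed.

Definition walk5 (t : G * G * G * G * G) : bool :=
  let: (v, p, q, r, s) := t in [&& adj v p, adj p q, adj q r, adj r s & adj s v].

Definition walk_vertices (t : G * G * G * G * G) : seq G :=
  let: (v, p, q, r, s) := t in [:: v; p; q; r; s].

Lemma adj_neq (x y : G) : adj x y -> x != y.
Proof. by apply: contraTneq => ->; rewrite adj_irr. Qed.

(** Equal vertices would be two steps apart on the walk, and the other three steps would form a
    triangle. *)
Lemma walk5_uniq t : walk5 t -> uniq (walk_vertices t).
Proof.
case: t => -[[[v p] q] r] s /= /and5P[vp pq qr rs sv].
have vq : v != q.
  by apply/eqP => e; apply: (no_triangle (x := q) (y := r) (z := s)); rewrite // -e adj_sym.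
have vr : v != r.
  by apply/eqP => e; apply: (no_triangle (x := v) (y := p) (z := q)); rewrite // e adj_sym.
have pr : p != r.
  by apply/eqP => e; apply: (no_triangle (x := v) (y := p) (z := s)); rewrite // 1?e // adj_sym.
have ps : p != s.
  by apply/eqP => e; apply: (no_triangle (x := p) (y := q) (z := r)); rewrite // e adj_sym.
have qs : q != s.
  by apply/eqP => e; apply: (no_triangle (x := v) (y := p) (z := q)); rewrite // e adj_sym.
by rewrite !inE !negb_or (adj_neq vp) (adj_neq pq) (adj_neq qr) (adj_neq rs)
  [v == s]eq_sym (adj_neq sv) vq vr pr ps qs.
Qed.

End Girth.

Section Factor.
Variable G : sgraph.
Hypotheses (cubic : regular G 3) (cyc4 : cyclically_edge_connected 4 G) (girth5 : girth_is G 5).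

Local Notation T5 := (G * G * G * G * G)%type.

Lemma boundary_walk5 (t : T5) : walk5 t -> boundary [set x in walk_vertices t] <= 5.
Proof.
case: t => -[[[v p] q] r] s wt; have ut := walk5_uniq girth5 wt; set S := [set x in _].
have cardS : #|S| = 5 by rewrite cardsE; move/card_uniqP: ut => ->.
have big2 (x y z : G) : x \in S -> y \in S -> z \in S ->
    adj x y -> adj x z -> y != z -> 1 < degree_in S x.
  move=> xS yS zS xy xz yz; have zS' : z \in S :\ y by apply/setD1P; rewrite eq_sym.
  by rewrite /degree_in (big_setD1 y yS) /= (big_setD1 z zS') /= xy xz.
have [inv inp inq inr ins] : [/\ v \in S, p \in S, q \in S, r \in S & s \in S].
  by split; rewrite !inE eqxx ?orbT.
move: ut wt; rewrite /= !inE !negb_or !andbT.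
case/and4P => /and4P[vp vq vr vs] /and3P[pq pr ps] /andP[qr qs] rs /and5P[avp apq aqr ars asv].
have : \sum_(x in S) 2 <= inner_degree S.
  apply: leq_sum => x; rewrite !inE => /or4P[|||/orP[]] /eqP->.
  - by apply: (big2 _ p s); rewrite // adj_sym.
  - by apply: (big2 _ v q); rewrite // adj_sym.
  - by apply: (big2 _ p r); rewrite // adj_sym.
  - by apply: (big2 _ q s); rewrite // adj_sym.
  - by apply: (big2 _ r v); rewrite // 1?adj_sym // eq_sym.
rewrite sum_nat_const cardS; have := boundaryE cubic S; rewrite cardS.
by clear; lia.
Qed.

Lemma fractional_third :
  fractional_matching [set: G] (fun x y => (adj x y)%:R / 3%:R)%R.
Proof.
split=> [x y|x y|x|x _|S _ oddS].
- by rewrite adj_sym.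
- by rewrite mulr_ge0 ?invr_ge0 ?ler0n.
- by rewrite adj_irr mul0r.
- rewrite -mulr_suml -natr_sum.
  rewrite (sum_boolE [set: G] (adj x)) (_ : [set y in _ | _] = [set y | adj x y]).
    by rewrite cubic divff.
  by apply/setP => y; rewrite !inE.
have := odd_boundary_ge3 cubic cyc4 oddS.
suff -> : cut (fun x y => (adj x y)%:R / 3%:R)%R [set: G] S = ((boundary S)%:R / 3%:R)%R.
  by move=> b3; rewrite ler_pdivlMr // mul1r ler_nat.
rewrite /cut /boundary natr_sum mulr_suml; apply: eq_bigr => x _.
rewrite /degree_in natr_sum mulr_suml; apply: eq_bigl => y.
by rewrite !inE andbT.
Qed.

(** The pairs [x], [m x] are the edges of a graph, and the cardinal is the degree sum of that graph
    inside [S]. *)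
Lemma walk_crossing_even (m : G -> G) (S : {set G}) :
  involutive m -> (forall x, m x != x) -> ~~ odd #|[set x in S | m x \in S]|.
Proof.
move=> mK mx.
have msym : symmetric (fun x y => m x == y) by move=> x y; rewrite eq_sym (can2_eq mK mK).
have mirr : irreflexive (fun x y => m x == y) by move=> x; apply/negbTE.
have := inner_degree_even (G := SGraph msym mirr) S.
rewrite /inner_degree /degree_in -sum1_card big_mkcond [in X in _ -> X]big_mkcond /=.
congr (~~ odd _); apply: eq_bigr => x _; rewrite inE; case: (x \in S) => //=.
rewrite big_mkcond (bigD1 (m x)) //= eqxx big1 ?addn0; first by case: (m x \in S).
by move=> y; rewrite eq_sym => /negbTE ->; case: (y \in S).
Qed.

Lemma matching_few_walks : exists m : G -> G,
  [/\ involutive m, forall x, adj x (m x) &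
   6 * #|[set t : T5 | walk5 t & all (fun x => m x \notin walk_vertices t) (walk_vertices t)]|
     <= #|[set t : T5 | walk5 t]|].
Proof.
(* [cr] marks the pairs with one end on the circuit; the cost of an edge is the number of walks that
   it leaves. *)
pose cr (t : T5) (x y : G) : nat := (x \in walk_vertices t) != (y \in walk_vertices t).
pose w (x y : G) : rat := ((\sum_(t : T5 | walk5 t) cr t x y)%:R)%R.
have [m mP le_m] := fractional_matching_cheap fractional_third w.
have mK : involutive m by move=> x; have [] := mP x (in_setT x).
have madj x : adj x (m x).
  by have [_ _] := mP x (in_setT x); case: (adj x (m x)) => //; rewrite mul0r ltxx.
have mneq x : m x != x by rewrite eq_sym; apply: adj_neq.
exists m; split=> //.
have nat_le : 3 * (\sum_(t : T5 | walk5 t) \sum_x cr t x (m x)) <=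
    \sum_(t : T5 | walk5 t) \sum_x \sum_(y | adj x y) cr t x y.
  rewrite -(ler_nat rat) natrM exchange_big natr_sum.
  have -> : \sum_(t : T5 | walk5 t) \sum_x \sum_(y | adj x y) cr t x y =
     \sum_x \sum_(y | adj x y) \sum_(t : T5 | walk5 t) cr t x y.
    by rewrite exchange_big; apply: eq_bigr => x _; rewrite exchange_big.
  have : (\sum_(x : G) w x (m x) <= value [set: G] (fun x y => (adj x y)%:R / 3%:R) w)%R.
    by move: le_m; rewrite (eq_bigl predT) // => x; rewrite inE.
  have -> : (value [set: G] (fun x y => (adj x y)%:R / 3%:R) w =
     (\sum_x \sum_(y | adj x y) \sum_(t : T5 | walk5 t) cr t x y)%:R / 3%:R)%R.
    rewrite /value natr_sum mulr_suml; apply: eq_big => [x|x _]; first by rewrite inE.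
    rewrite natr_sum mulr_suml [RHS]big_mkcond; apply: eq_big => [y|y _].
      by rewrite inE.
    by rewrite -/(w x y); case: adj; rewrite ?mul0r // mul1r mulrC.
  by rewrite ler_pdivlMr // mulrC.
set Z := [set t | _ & _].
(* The factor 2 counts each leaving matching edge from both ends. Their number is odd, hence at
   least 1, and it is 5 = 1 + 4 for the walks in [Z]. *)
have lower : 2 * (#|[set t : T5 | walk5 t]| + 4 * #|Z|) <= \sum_(t : T5 | walk5 t) \sum_x cr t x (m x).
  rewrite -!sum1_card; under eq_bigl => t do rewrite inE.
  have -> : \sum_(t in Z) 1 = \sum_(t : T5 | walk5 t)
     (all (fun x => m x \notin walk_vertices t) (walk_vertices t)).
    rewrite big_mkcond [RHS]big_mkcond; apply: eq_bigr => t _; rewrite inE.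
    by case: (walk5 t) => //=; case: all.
  rewrite [4 * _]big_distrr -big_split big_distrr; apply: leq_sum => t wt /=.
  pose S := [set x in walk_vertices t].
  have cardS : #|S| = 5.
    by rewrite cardsE; move/card_uniqP: (walk5_uniq girth5 wt) => ->; case: t {wt S} => -[[[v p] q] r] s.
  have crE x : cr t x (m x) = ((x \in S) && (m x \notin S)) + ((x \notin S) && (m x \in S)).
    by rewrite /cr !inE; case: (x \in _); case: (m x \in _).
  have -> : \sum_x cr t x (m x) = 2 * #|[set x in S | m x \notin S]|.
    under eq_bigr => x _ do rewrite crE.
    rewrite big_split /= [X in _ + X](reindex_inj (inv_inj mK)) /= mul2n -addnn.
    rewrite -sum1_card [X in _ = X + X]big_mkcond; congr (_ + _); apply: eq_bigr => x _.
      by rewrite inE; case: (_ && _).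
    by rewrite inE mK andbC; case: (_ && _).
  rewrite leq_mul2l /=.
  have split5 : #|[set x in S | m x \in S]| + #|[set x in S | m x \notin S]| = 5.
    rewrite -cardS -(cardsID [set x | m x \in S] S); congr (_ + _)%N; apply: eq_card => x;
    by rewrite !inE // andbC.
  have ev := walk_crossing_even S mK mneq.
  case: allP => [al|_] /=; last first.
    by case: #|[set x in S | m x \notin S]| split5 => //; rewrite addn0 => e; rewrite e in ev.
  have -> : [set x in S | m x \notin S] = S; last by rewrite cardS.
  by apply/setP => x; rewrite !inE; case xt: (x \in walk_vertices t) => //=; apply: al.
have upper : \sum_(t : T5 | walk5 t) \sum_x \sum_(y | adj x y) cr t x y <= \sum_(t : T5 | walk5 t) 10.
  apply: leq_sum => t wt; pose S := [set x in walk_vertices t].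
  have := boundary_walk5 wt; rewrite -/S => b5.
  suff -> : \sum_x \sum_(y | adj x y) cr t x y = boundary S + boundary (~: S).
    by rewrite boundaryC; move: b5; clear; lia.
  rewrite [LHS](bigID (mem S)) /=; congr (_ + _).
    apply: eq_bigr => x xS; rewrite /degree_in big_mkcond [RHS]big_mkcond; apply: eq_bigr => y _.
    move: xS; rewrite /cr !inE => ->.
    by case: (adj x y); case: (y \in walk_vertices t).
  rewrite /boundary; apply: eq_big => [x|x xS]; first by rewrite in_setC.
  rewrite /degree_in big_mkcond [RHS]big_mkcond; apply: eq_bigr => y _.
  move: xS; rewrite /cr !inE => /negbTE ->.
  by case: (adj x y); case: (y \in walk_vertices t).
(* With [W] walks the three estimates combine to [6 * (W + 4 * #|Z|) <= 10 * W]. *)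
move: upper; rewrite sum_nat_const; move: nat_le lower.
have -> : #|walk5 (G:=G)| = #|[set t : T5 | walk5 t]| by rewrite cardsE.
by clear; lia.
Qed.

End Factor.

(** * From closed walks to circuits *)

Section CircuitCount.
Variable G : sgraph.
Implicit Types c : seq G.

Lemma circuit_edges_rot n c : uniq c -> circuit_edges (rot n c) = circuit_edges c.
Proof.
move=> uc; apply/setP => e; apply/imsetP/imsetP => -[x xc ->]; exists x;
  by rewrite ?next_rot ?mem_rot // in xc *.
Qed.

Lemma circuit_edges_rev c : uniq c -> circuit_edges (rev c) = circuit_edges c.
Proof.
move=> uc; apply/setP => e; apply/imsetP/imsetP => -[x xc ->].
  exists (prev c x); first by rewrite mem_prev -mem_rev.
  by rewrite next_rev // next_prev // setUC.
exists (next c x); first by rewrite mem_rev mem_next.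
by rewrite next_rev // prev_next // setUC.
Qed.

Lemma circuit_rot n c : circuit (rot n c) = circuit c.
Proof. by rewrite /circuit size_rot /ucycleb rot_cycle rot_uniq. Qed.

Lemma circuit_rev c : circuit (rev c) = circuit c.
Proof.
rewrite /circuit size_rev /ucycleb rev_cycle rev_uniq; congr [&& _, _ & _].
by apply: eq_cycle => x y; rewrite adj_sym.
Qed.

(** The five rotations of a list and of its reversal have the same edge set. *)
Lemma circuits5_le : 10 * #|circuits_of_length G 5| <= #|[set c : 5.-tuple G | circuit c]|.
Proof.
rewrite /circuits_of_length -[leqRHS]sum1_card.
rewrite (partition_big_imset (fun c : 5.-tuple G => circuit_edges c)) /=.
rewrite mulnC -sum_nat_const.
rewrite (eq_bigl (fun E => E \in
  [set circuit_edges c | c : 5.-tuple G in [set c : 5.-tuple G | circuit c]])); last first.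
  by move=> E; apply/imsetP/imsetP => -[c]; rewrite ?inE => cP ->; exists c; rewrite ?inE.
apply: leq_sum => E /imsetP[c + ->]; rewrite inE => cP {E}.
have uc : uniq c by case/and3P: cP.
pose L := [seq rot_tuple i c | i <- iota 0 5] ++ [seq rot_tuple i (rev_tuple c) | i <- iota 0 5].
have sL : {subset L <= [pred c' : 5.-tuple G | (c' \in [set c' : 5.-tuple G | circuit c'])
    && (circuit_edges c' == circuit_edges c)]}.
  move=> c'; rewrite mem_cat => /orP[] /mapP[i _ ->]; rewrite !inE /= !circuit_rot ?circuit_rev cP.
    by rewrite circuit_edges_rot ?eqxx.
  by rewrite circuit_edges_rot ?rev_uniq // circuit_edges_rev ?eqxx.
rewrite sum1dep_card; suff uL : uniq L.
  rewrite (_ : 10 = size L) //; move/card_uniqP: (uL) => <-.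
  by apply: subset_leq_card; apply/subsetP => z /sL; rewrite !inE /= ?inE.
(* The ten lists already differ in their first two entries. *)
apply: (@map_uniq _ _ (fun c' : 5.-tuple G => (tnth c' ord0, tnth c' (inord 1)))).
case: c uc {cP sL} @L => -[|x0 [|x1 [|x2 [|x3 [|x4 [|? ?]]]]]] //= sz uc.
have /and5P[n1 n2 n3 n4 /and5P[n5 n6 n7 n8 /andP[n9 n10]]] : [&& x0 != x1, x0 != x2,
   x0 != x3, x0 != x4, x1 != x2, x1 != x3, x1 != x4, x2 != x3, x2 != x4 & x3 != x4].
  by move: uc; rewrite !inE !negb_or -!andbA andbT.
rewrite !(tnth_nth x0) /= !inordK //= !inE !xpair_eqE.
rewrite !(eq_sym x1 x0, eq_sym x2 x0, eq_sym x3 x0, eq_sym x4 x0, eq_sym x2 x1, eq_sym x3 x1,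
  eq_sym x4 x1, eq_sym x3 x2, eq_sym x4 x2, eq_sym x4 x3).
by rewrite !(negbTE n1, negbTE n2, negbTE n3, negbTE n4, negbTE n5, negbTE n6, negbTE n7,
  negbTE n8, negbTE n9, negbTE n10) !eqxx.
Qed.

End CircuitCount.

(** * The 2-factor complementary to a perfect matching *)

Section MatchingComplement.
Variables (G : sgraph) (m : G -> G).
Hypotheses (cubic : regular G 3) (mK : involutive m) (madj : forall x, adj x (m x)).

Definition complement_edges : {set {set G}} := [set e in edges G | [forall u, e != [set u; m u]]].

Lemma complement_adj x y : spanning_adj complement_edges x y = adj x y && (y != m x).
Proof.
rewrite /spanning_adj inE; case xy: (adj x y) => //=.
have -> : [set x; y] \in edges G by apply/imsetP; exists (x, y); rewrite ?inE.
apply/forallP/idP => [/(_ x)|ymx u].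
  by apply: contraNneq => ->.
apply: contraNneq ymx => e.
have : (u \in [set x; y]) && (m u \in [set x; y]) by rewrite e !inE !eqxx orbT.
have : (x \in [set u; m u]) && (y \in [set u; m u]) by rewrite -e !inE !eqxx orbT.
rewrite !inE => /andP[/orP[]/eqP xu /orP[]/eqP yu].
- by rewrite xu yu adj_irr in xy.
- by rewrite yu xu.
- by rewrite yu xu mK.
by rewrite xu yu adj_irr in xy.
Qed.

Lemma two_factor_complement : two_factor complement_edges.
Proof.
split=> [|x]; first by apply/subsetP => e; rewrite inE => /andP[].
have := cubic x; rewrite (cardsD1 (m x)) inE madj => -[<-].
by apply: eq_card => y; rewrite !inE /= complement_adj andbC.
Qed.

Hypothesis girth5 : girth_is G 5.

(** On a 5-circuit of the 2-factor, the partner of a vertex is neither of its two neighbours there,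
    and a matching edge to one of the other two vertices would be a chord cutting off a triangle. *)
Lemma complement_circuits_le :
  10 * #|circuits_of_length (spanning_subgraph complement_edges) 5| <=
  #|[set t | walk5 t & all (fun x => m x \notin walk_vertices t) (walk_vertices t)]|.
Proof.
apply: leq_trans (circuits5_le _) _.
pose f (c : 5.-tuple G) :=
  (tnth c (inord 0), tnth c (inord 1), tnth c (inord 2), tnth c (inord 3), tnth c (inord 4)).
have f_inj : injective f.
  move=> c d; rewrite /f => -[e0 e1 e2 e3 e4]; apply: eq_from_tnth => i.
  by rewrite -(inord_val i); case: i => [[|[|[|[|[|//]]]]] Hi].
rewrite -(card_imset _ f_inj); apply: subset_leq_card; apply/subsetP => _ /imsetP[c + ->].
rewrite !inE /f; case: c => -[|v [|p [|q [|r [|s [|? ?]]]]]] //= sz.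
rewrite !(tnth_nth v) /= !inordK //= /circuit /ucycleb /= !complement_adj -!andbA.
case/and5P=> vp vp' pq pq' /and5P[qr qr' rs rs' /and3P[sv sv' _]].
apply/and5P; split=> //; rewrite sv.
have key a b c d e : adj a b -> adj b c -> adj d e -> adj e a ->
    b != m a -> a != m e -> m a \notin [:: a; b; c; d; e].
  move=> ab bc de ea nb ne; have am := madj a; rewrite !inE !negb_or; apply/and5P; split.
  - by apply: contraTneq am => ->; rewrite adj_irr.
  - by rewrite eq_sym.
  - apply/eqP => e1; rewrite e1 in am; exact: (no_triangle girth5 ab bc am).
  - apply/eqP => e1; rewrite e1 in am; apply: (no_triangle girth5 am de); by rewrite adj_sym.
  by apply: contra ne => /eqP <-; rewrite mK.
have mem1 : [:: p; q; r; s; v] =i [:: v; p; q; r; s] by apply: (mem_rot 1 [:: v; p; q; r; s]).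
have mem2 : [:: q; r; s; v; p] =i [:: v; p; q; r; s] by apply: (mem_rot 2 [:: v; p; q; r; s]).
have mem3 : [:: r; s; v; p; q] =i [:: v; p; q; r; s] by apply: (mem_rot 3 [:: v; p; q; r; s]).
have mem4 : [:: s; v; p; q; r] =i [:: v; p; q; r; s] by apply: (mem_rot 4 [:: v; p; q; r; s]).
rewrite andbT /=; apply/and5P; split.
- exact: key.
- by rewrite -mem1; apply: key.
- by rewrite -mem2; apply: key.
- by rewrite -mem3; apply: key.
by rewrite -mem4; apply: key.
Qed.

End MatchingComplement.

(** * Closed 5-walks through a vertex *)

Section Local.
Variable G : sgraph.
Hypotheses (cubic : regular G 3) (girth5 : girth_is G 5).
Local Notation T5 := (G * G * G * G * G)%type.
Implicit Types (x y z v a b c : G).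

Definition neighbours x a b c : Prop :=
  uniq [:: a; b; c] /\ forall y, adj x y = (y \in [:: a; b; c]).

Lemma neighbours_perm x a b c a' b' c' : perm_eq [:: a; b; c] [:: a'; b'; c'] ->
  neighbours x a b c -> neighbours x a' b' c'.
Proof.
move=> perm [u xE]; split; first by rewrite -(perm_uniq perm).
by move=> y; rewrite xE (perm_mem perm).
Qed.

Lemma neighbours_swap x a b c : neighbours x a b c -> neighbours x a c b.
Proof. by apply: neighbours_perm; rewrite perm_cons (perm_catC [:: b] [:: c]). Qed.

Lemma neighbours_rot x a b c : neighbours x a b c -> neighbours x b c a.
Proof. by apply: neighbours_perm; rewrite (perm_catC [:: a] [:: b; c]). Qed.

Lemma neighbours_exists x : exists a b c, neighbours x a b c.
Proof.
have := cubic x; rewrite cardE; case En: (enum _) => [|a [|b [|c [|? ?]]]] // _.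
exists a, b, c; split; first by rewrite -En enum_uniq.
by move=> y; rewrite -En mem_enum inE.
Qed.

Lemma neighbours_exists1 x a : adj x a -> exists b c, neighbours x a b c.
Proof.
have [p [q [r N]]] := neighbours_exists x; rewrite (N.2 a) !inE => /or3P[]/eqP->.
- by exists q, r.
- by exists r, p; apply: neighbours_rot.
by exists p, q; do 2 apply: neighbours_rot.
Qed.

Lemma neighbours_exists2 x a b : adj x a -> adj x b -> a != b -> exists c, neighbours x a b c.
Proof.
move=> xa xb ab; have [p [q N]] := neighbours_exists1 xa.
move: xb; rewrite (N.2 b) !inE [b == a]eq_sym (negbTE ab) /= => /orP[]/eqP->; first by exists q.
by exists p; apply: neighbours_swap.
Qed.

Lemma sum_neighbours x a b c (F : G -> nat) : neighbours x a b c ->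
  \sum_(y | adj x y) F y = F a + F b + F c.
Proof.
move=> [u xE]; rewrite (eq_bigl (mem [:: a; b; c])) -?big_uniq //=.
by rewrite !big_cons big_nil addn0 addnA.
Qed.

Definition walks_at v : nat := #|[set t : T5 | walk5 t & t.1.1.1.1 == v]|.

(** The number of walks [x p q y]. For distinct neighbours [x], [y] of [v] it is the number of
    5-circuits through [x v y]. *)
Definition paths3 x y : nat := \sum_(p | adj x p) \sum_(q | adj y q) adj p q.
Definition common x y : nat := \sum_(p | adj x p) adj p y.

Lemma walks_atE v : walks_at v = \sum_(x | adj v x) \sum_(y | adj v y) paths3 x y.
Proof.
rewrite /walks_at -sum1_card.
under eq_bigl => t do rewrite inE.
rewrite big_mkcond /=.
pose g v' p q r s :=
  if [&& adj v' p, adj p q, adj q r, adj r s & adj s v'] && (v' == v) then 1 else 0.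
rewrite (eq_bigr (fun t : T5 => g t.1.1.1.1 t.1.1.1.2 t.1.1.2 t.1.2 t.2)); last by move=> [[[[]]]].
rewrite -(pair_bigA _ (fun t s => g t.1.1.1 t.1.1.2 t.1.2 t.2 s)) /=.
rewrite -(pair_bigA _ (fun t r => \sum_s g t.1.1 t.1.2 t.2 r s)) /=.
rewrite -(pair_bigA _ (fun t q => \sum_r \sum_s g t.1 t.2 q r s)) /=.
rewrite -(pair_bigA _ (fun v' p => \sum_q \sum_r \sum_s g v' p q r s)) /= /g.
rewrite (bigD1 v) //= [X in _ + X]big1 ?addn0; last first.
  move=> u /negbTE uv; do 4 (rewrite big1 // => ? _).
  by rewrite uv andbF.
rewrite [RHS]big_mkcond; apply: eq_bigr => p _.
case vp: (adj v p); last by do 3 (rewrite big1 // => ? _).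
rewrite /paths3 exchange_big /= (eq_bigr (fun r => \sum_s \sum_(q | adj p q)
   if [&& adj q r, adj r s & adj s v] then 1 else 0)); last first.
  move=> r _; rewrite exchange_big; apply: eq_bigr => s _; rewrite [RHS]big_mkcond.
  by apply: eq_bigr => q _; rewrite eqxx andbT; case: (adj p q).
rewrite exchange_big [RHS]big_mkcond; apply: eq_bigr => s _.
rewrite [adj v s]adj_sym; case sv: (adj s v); last first.
  by do 2 (rewrite big1 // => ? _); rewrite !andbF.
rewrite exchange_big; apply: eq_bigr => q _; rewrite [RHS]big_mkcond; apply: eq_bigr => r _.
by rewrite andbT andbC [adj r s]adj_sym; case: (adj s r); case: (adj q r).
Qed.

Lemma paths3C x y : paths3 x y = paths3 y x.
Proof.
rewrite /paths3 exchange_big; apply: eq_bigr => p _; apply: eq_bigr => q _.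
by rewrite adj_sym.
Qed.

Lemma paths3E x y : paths3 x y = \sum_(p | adj x p) common p y.
Proof.
apply: eq_bigr => p _; rewrite /common big_mkcond [RHS]big_mkcond; apply: eq_bigr => q _.
by rewrite [adj q y]adj_sym; case: (adj y q); case: (adj p q).
Qed.

Lemma common_adj x y : adj x y -> common x y = 0.
Proof.
move=> xy; rewrite /common big1 // => p xp.
by case py: (adj p y) => //; case: (no_triangle girth5 xp py xy).
Qed.

Lemma common_le1 x y : x != y -> common x y <= 1.
Proof.
move=> xy; have -> : common x y = #|[set p | adj x p && adj p y]|.
  rewrite /common -sum1_card big_mkcond [RHS]big_mkcond; apply: eq_bigr => p _.
  by rewrite inE; case: (adj x p); case: (adj p y).
rewrite leqNgt; apply/negP => /card_gt1P[p [q []]]; rewrite !inE => /andP[xp py] /andP[xq qy] pq.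
by apply: (no_square girth5 xp py _ _ xy pq); rewrite adj_sym.
Qed.

Lemma paths3_loop x : paths3 x x = 0.
Proof.
rewrite /paths3 big1 // => p xp; rewrite big1 // => q xq.
by case pq: (adj p q) => //; case: (no_triangle girth5 xp pq xq).
Qed.

Lemma paths3_arms v a b a1 a2 b1 b2 : neighbours a v a1 a2 -> neighbours b v b1 b2 ->
  paths3 a b = adj a1 b1 + adj a1 b2 + adj a2 b1 + adj a2 b2.
Proof.
move=> Na Nb; have av : adj a v by rewrite Na.2 inE eqxx.
have bv : adj b v by rewrite Nb.2 inE eqxx.
rewrite /paths3 (sum_neighbours _ Na) !(sum_neighbours _ Nb) adj_irr.
have F x y : adj x v -> adj x y -> adj v y = false.
  move=> xv xy; apply/negP => vy; exact: (no_triangle girth5 xv vy xy).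
have a1F : adj v a1 = false by apply: (F a); rewrite // Na.2 !inE eqxx orbT.
have a2F : adj v a2 = false by apply: (F a); rewrite // Na.2 !inE eqxx !orbT.
have b1F : adj v b1 = false by apply: (F b); rewrite // Nb.2 !inE eqxx orbT.
have b2F : adj v b2 = false by apply: (F b); rewrite // Nb.2 !inE eqxx !orbT.
by rewrite ![adj _ v]adj_sym a1F a2F b1F b2F /= !add0n !addnA.
Qed.

(** Walks are sorted by their vertex next to [x]; [v] contributes none, as it has no common
    neighbour with [y]. Only the vertices around [x] enter, so the other neighbours of [y] may
    remain unknown. *)
Lemma paths3_two_steps v x y x1 x2 p q r s : adj v y -> neighbours x v x1 x2 ->
  neighbours x1 x p q -> neighbours x2 x r s ->
  paths3 x y = adj p y + adj q y + adj r y + adj s y.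
Proof.
move=> vy Nx N1 N2; have vx : adj v x by rewrite adj_sym Nx.2 inE eqxx.
have xy : adj x y = false by apply/negP => xy; apply: (no_triangle girth5 vx xy vy).
rewrite paths3E (sum_neighbours _ Nx) (common_adj vy) /common.
by rewrite (sum_neighbours _ N1) (sum_neighbours _ N2) xy /= !add0n !addnA.
Qed.

Lemma walks_at_neighbours v a b c : neighbours v a b c ->
  walks_at v = 2 * (paths3 a b + paths3 a c + paths3 b c).
Proof.
move=> N; rewrite walks_atE (sum_neighbours _ N) !(sum_neighbours _ N) !paths3_loop.
by rewrite (paths3C b a) (paths3C c a) (paths3C c b); clear; lia.
Qed.

(** * Balls of radius 2 *)

Definition ball2 v a b c a1 a2 b1 b2 c1 c2 : Prop :=
  [/\ neighbours v a b c, neighbours a v a1 a2, neighbours b v b1 b2 & neighbours c v c1 c2].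

Definition ball2_seq v a b c a1 a2 b1 b2 c1 c2 := [:: v; a; b; c; a1; a2; b1; b2; c1; c2].

Lemma ball2_exists v : exists a b c a1 a2 b1 b2 c1 c2, ball2 v a b c a1 a2 b1 b2 c1 c2.
Proof.
have [a [b [c N]]] := neighbours_exists v.
have [va vb vc] : [/\ adj a v, adj b v & adj c v].
  by split; rewrite adj_sym N.2 !inE eqxx ?orbT.
have [a1 [a2 Na]] := neighbours_exists1 va; have [b1 [b2 Nb]] := neighbours_exists1 vb.
by have [c1 [c2 Nc]] := neighbours_exists1 vc; exists a, b, c, a1, a2, b1, b2, c1, c2.
Qed.

Lemma ball2_uniq v a b c a1 a2 b1 b2 c1 c2 : ball2 v a b c a1 a2 b1 b2 c1 c2 ->
  uniq (ball2_seq v a b c a1 a2 b1 b2 c1 c2).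
Proof.
case=> N Na Nb Nc.
have adjN x p q r : neighbours x p q r -> [/\ adj x p, adj x q & adj x r].
  by case=> _ E; split; rewrite E !inE eqxx ?orbT.
have [va vb vc] := adjN _ _ _ _ N; have [av aa1 aa2] := adjN _ _ _ _ Na.
have [bv bb1 bb2] := adjN _ _ _ _ Nb; have [cv cc1 cc2] := adjN _ _ _ _ Nc.
have [/and3P[/norP[ab /norP[ac _]] /norP[bc _] _]] := N.1.
have [/and3P[/norP[va1 /norP[va2 _]] /norP[a12 _] _]] := Na.1.
have [/and3P[/norP[vb1 /norP[vb2 _]] /norP[b12 _] _]] := Nb.1.
have [/and3P[/norP[vc1 /norP[vc2 _]] /norP[c12 _] _]] := Nc.1.
have far x y z : adj v x -> adj v y -> adj x z -> y != z.
  by move=> vx vy xz; apply: contraTneq isT => yz; case: (no_triangle girth5 vx xz); rewrite -yz.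
have apart x y z w : adj v x -> adj v y -> x != y -> v != z -> adj x z -> adj y w -> z != w.
  move=> vx vy xy vz xz yw; apply: contraTneq isT => zw.
  by case: (no_square girth5 vx xz (w := y)) => //; rewrite ?zw // adj_sym.
rewrite /ball2_seq /= !inE !negb_or -!andbA.
by do ![apply/andP; split] => //; first [exact: adj_neq|exact: (far a)|exact: (far b)|exact: (far c)
  |exact: (apart a b)|exact: (apart a c)|exact: (apart b c)].
Qed.

Lemma degree_in_ge (S : {set G}) x (s : seq G) : uniq s -> {subset s <= S} ->
  \sum_(y <- s) adj x y <= degree_in S x.
Proof.
move=> us sS; rewrite big_uniq //= /degree_in big_mkcond [leqRHS]big_mkcond.
by apply: leq_sum => y _; case ys: (y \in s) => //; rewrite sS.
Qed.

(** The degree sum 30 of the ball is reduced by 18 for the nine edges of the tree, and by 2 for each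
    edge joining leaves of different arms. Such an edge closes one 5-circuit through [v], that is
    two walks. *)
Lemma boundary_ball2 v a b c a1 a2 b1 b2 c1 c2 : ball2 v a b c a1 a2 b1 b2 c1 c2 ->
  boundary [set x in ball2_seq v a b c a1 a2 b1 b2 c1 c2] + walks_at v <= 12.
Proof.
move=> B; have uL := ball2_uniq B; case: B => N Na Nb Nc.
set L := ball2_seq _ _ _ _ _ _ _ _ _ _ in uL *; set S := [set x in L].
rewrite (walks_at_neighbours N) (paths3_arms Na Nb) (paths3_arms Na Nc) (paths3_arms Nb Nc).
have cardS : #|S| = 10 by rewrite cardsE; move/card_uniqP: uL => ->.
have inL : {subset L <= S} by move=> x xL; rewrite in_set.
have row x s : uniq s -> {subset s <= L} -> \sum_(y <- s) adj x y <= degree_in S x.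
  by move=> us sL; apply: degree_in_ge => // y /sL/inL.
have adjN x p q r : neighbours x p q r -> [/\ adj x p, adj x q & adj x r].
  by case=> _ E; split; rewrite E !inE eqxx ?orbT.
have [va vb vc] := adjN _ _ _ _ N; have [av aa1 aa2] := adjN _ _ _ _ Na.
have [bv bb1 bb2] := adjN _ _ _ _ Nb; have [cv cc1 cc2] := adjN _ _ _ _ Nc.
have bound : inner_degree S = \sum_(x <- L) degree_in S x.
  by rewrite /inner_degree big_uniq //; apply: eq_bigl => x; rewrite in_set.
have ntn (ns : seq nat) : uniq ns -> all (fun i => i < 10) ns ->
    uniq [seq nth v L i | i <- ns] /\ {subset [seq nth v L i | i <- ns] <= L}.
  move=> un /allP lt; split.
    by rewrite map_inj_in_uniq // => i j /lt i10 /lt j10 /eqP; rewrite nth_uniq // => /eqP.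
  by move=> x /mapP[i /lt i10 ->]; apply: mem_nth.
have rowi x (ns : seq nat) : uniq ns -> all (fun i => i < 10) ns ->
    \sum_(i <- ns) adj x (nth v L i) <= degree_in S x.
  move=> un lt; have [u s] := ntn ns un lt.
  by rewrite -(big_map _ predT (fun y => adj x y : nat)); apply: row.
have := boundaryE cubic S; rewrite bound cardS /L !big_cons big_nil.
have := rowi v [:: 1; 2; 3] isT isT; have := rowi a [:: 0; 4; 5] isT isT.
have := rowi b [:: 0; 6; 7] isT isT; have := rowi c [:: 0; 8; 9] isT isT.
have := rowi a1 [:: 1; 6; 7; 8; 9] isT isT; have := rowi a2 [:: 1; 6; 7; 8; 9] isT isT.
have := rowi b1 [:: 2; 4; 5; 8; 9] isT isT; have := rowi b2 [:: 2; 4; 5; 8; 9] isT isT.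
have := rowi c1 [:: 3; 4; 5; 6; 7] isT isT; have := rowi c2 [:: 3; 4; 5; 6; 7] isT isT.
rewrite !big_cons !big_nil /= va vb vc av aa1 aa2 bv bb1 bb2 cv cc1 cc2.
rewrite ![adj _ a]adj_sym ![adj _ b]adj_sym ![adj _ c]adj_sym aa1 aa2 bb1 bb2 cc1 cc2.
rewrite (adj_sym b1 a1) (adj_sym b1 a2) (adj_sym b2 a1) (adj_sym b2 a2).
rewrite (adj_sym c1 a1) (adj_sym c1 a2) (adj_sym c2 a1) (adj_sym c2 a2).
rewrite (adj_sym c1 b1) (adj_sym c1 b2) (adj_sym c2 b1) (adj_sym c2 b2).
move: (boundary S) (degree_in S); clear=> bd dg.
move: (adj a1 b1 : nat) (adj a1 b2 : nat) (adj a2 b1 : nat) (adj a2 b2 : nat)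
  (adj a1 c1 : nat) (adj a1 c2 : nat) (adj a2 c1 : nat) (adj a2 c2 : nat)
  (adj b1 c1 : nat) (adj b1 c2 : nat) (adj b2 c1 : nat) (adj b2 c2 : nat).
by move: (dg v) (dg a) (dg b) (dg c) (dg a1) (dg a2) (dg b1) (dg b2) (dg c1) (dg c2) => /=; lia.
Qed.

End Local.

(** * Vertices on four 5-circuits *)

Ltac use_neq :=
  match goal with
  | H : is_true (?x != ?y) |- context [?x == ?y] => rewrite (negbTE H)
  | H : is_true (?x != ?y) |- context [?y == ?x] => rewrite (eq_sym y x) (negbTE H)
  | |- context [?x == ?x] => rewrite eqxx
  end.

(** Evaluates an adjacency as soon as the neighbours of one of its ends are known. *)
Ltac look_up :=
  repeat match goal with
  | N : neighbours ?p _ _ _ |- context [@adj _ ?p ?q] => rewrite (proj2 N q)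
  | N : neighbours ?p _ _ _ |- context [@adj _ ?q ?p] => rewrite (adj_sym q p) (proj2 N q)
  end; rewrite ?inE; repeat use_neq; rewrite /=.

Ltac permute_neighbours :=
  solve [ assumption | apply: neighbours_swap; assumption | apply: neighbours_rot; assumption
  | apply: neighbours_rot; apply: neighbours_rot; assumption
  | apply: neighbours_swap; apply: neighbours_rot; assumption
  | apply: neighbours_swap; apply: neighbours_rot; apply: neighbours_rot; assumption ].

Ltac split_uniq U :=
  move: (U); rewrite /ball2_seq /= !inE !negb_or -?andbA; repeat (case/andP => ?); move=> _.

Ltac split_notin H :=
  move: (H); rewrite /ball2_seq !inE !negb_or -?andbA; repeat (case/andP => ?); move=> ?.

Ltac permute_ball B := by case: (B) => *; split; permute_neighbours.

Section BadVertices.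
Variable G : sgraph.
Hypotheses (cubic : regular G 3) (cyc4 : cyclically_edge_connected 4 G) (girth5 : girth_is G 5).
Local Notation T5 := (G * G * G * G * G)%type.
Implicit Types (x y z v a b c o u : G) (S : {set G}).

Lemma boundaryU1 o S : o \notin S -> boundary (o |: S) + 2 * degree_in S o = boundary S + 3.
Proof.
move=> oS; have := boundaryE cubic (o |: S); have := boundaryE cubic S.
rewrite (inner_degreeD1 (A := o |: S) (x := o)) ?setU11 // setU1K // cardsU1 oS.
have -> : degree_in (o |: S) o = degree_in S o by rewrite /degree_in big_setU1 //= adj_irr.
by clear; lia.
Qed.

Lemma no_small_cut S : 2 < #|S| -> 2 < #|~: S| -> 3 < boundary S.
Proof.
move=> S3 C3; rewrite ltnNge; apply/negP => b3.
have Sn0 : S != set0 by rewrite -card_gt0; apply: leq_trans S3.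
have SnT : S != setT by apply: contraTneq C3 => ->; rewrite setCT cards0.
have := boundary_ge4 cubic cyc4 Sn0 SnT (leq_trans b3 S3) (leq_trans b3 C3).
by rewrite ltnNge b3.
Qed.

Lemma card_ball2 v a b c a1 a2 b1 b2 c1 c2 : ball2 v a b c a1 a2 b1 b2 c1 c2 ->
  #|[set x in ball2_seq v a b c a1 a2 b1 b2 c1 c2]| = 10.
Proof. by move/(ball2_uniq girth5)/card_uniqP => e; rewrite cardsE e. Qed.

(** By parity a larger value is at least 10. Then at most two edges leave the ball, and the two
    vertices that lie outside it for n >= 12 are enough for a circuit there. *)
Lemma walks_at_le8 v : 11 < #|G| -> walks_at v <= 8.
Proof.
move=> n12; have [a [b [c [a1 [a2 [b1 [b2 [c1 [c2 B]]]]]]]]] := ball2_exists cubic v.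
have := boundary_ball2 cubic girth5 B; set S := [set x in _] => le12.
have cardS : #|S| = 10 := card_ball2 B; have cardC := cardsC S.
have [N _ _ _] := B; rewrite leqNgt; apply/negP => gt8.
have b2' : boundary S <= 2.
  by move: le12 gt8; rewrite (walks_at_neighbours girth5 N); clear; lia.
have Sn0 : S != set0 by rewrite -card_gt0 cardS.
have SnT : S != setT.
  by apply/eqP => ST; move: cardC n12; rewrite ST setCT cards0 -ST cardS; clear; lia.
have := boundary_ge4 cubic cyc4 Sn0 SnT.
by move: b2' n12 cardC; rewrite cardS; clear; lia.
Qed.

Lemma degree_in_neighbours S x a b c : neighbours x a b c ->
  degree_in S x = (a \in S) + (b \in S) + (c \in S).
Proof.
move=> N; rewrite -(sum_neighbours (fun y => y \in S) N) /degree_in big_mkcond [RHS]big_mkcond.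
by apply: eq_bigr => y _; case: (y \in S); case: (adj x y).
Qed.

Lemma neighbours_of_adj x a b c : adj x a -> adj x b -> adj x c -> uniq [:: a; b; c] ->
  neighbours x a b c.
Proof.
move=> xa xb xc u; have [p [q [r N]]] := neighbours_exists cubic x.
split=> // y; rewrite N.2.
have [|//|_ ->//] := @uniq_min_size _ [:: a; b; c] [:: p; q; r] u.
by move=> z; rewrite -N.2 !inE => /or3P[]/eqP->.
Qed.

(** * The ball around a vertex on four 5-circuits *)

Section Ball.
Variables v a b c a1 a2 b1 b2 c1 c2 : G.
Hypotheses (n16 : 15 < #|G|) (B : ball2 v a b c a1 a2 b1 b2 c1 c2) (bad : walks_at v = 8).
Let S := [set x in ball2_seq v a b c a1 a2 b1 b2 c1 c2].

Let cardS : #|S| = 10. Proof. exact: card_ball2. Qed.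
Let bS : boundary S <= 4.
Proof. by have := boundary_ball2 cubic girth5 B; rewrite bad -/S; clear; lia. Qed.

(** Adding a vertex with two neighbours in the ball would lower the at most four outgoing edges to
    at most three. *)
Lemma outside_degree o : o \notin S -> degree_in S o <= 1.
Proof.
move=> oS; rewrite leqNgt; apply/negP => d2.
have := no_small_cut (S := o |: S); have := boundaryU1 oS; have := cardsC (o |: S).
rewrite cardsU1 oS cardS.
by move: bS n16 d2; clear; lia.
Qed.

Lemma outside_unique o x y : o \notin S -> x \in S -> y \in S -> adj o x -> adj o y -> x = y.
Proof.
move=> oS xS yS ox oy; apply/eqP; apply: contraT => xy.
have := outside_degree oS; rewrite leqNgt /degree_in (big_setD1 x) //= (big_setD1 y) /= ?ox ?oy //.
by apply/setD1P; rewrite eq_sym.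
Qed.

(** Removing a vertex with at most one neighbour inside would lower the at most four outgoing edges
    as well. *)
Lemma inside_degree u : u \in S -> 1 < degree_in S u.
Proof.
move=> uS; rewrite ltnNge; apply/negP => d1.
have uS' : u \notin S :\ u by rewrite !inE eqxx.
have := boundaryU1 uS'; rewrite setD1K // => e.
have d1' : degree_in (S :\ u) u <= 1.
  by apply: leq_trans d1; rewrite /degree_in [leqRHS](big_setD1 u) //= leq_addl.
have := no_small_cut (S := S :\ u); have := cardsC (S :\ u).
have : #|S :\ u| = 9 by have := cardsD1 u S; rewrite uS cardS; clear; lia.
by move: bS n16 d1' e; clear; lia.
Qed.

(** As the three vertices are added one by one, the bound 4 on the outgoing edges becomes 5, 4 and
    3. The result has 13 vertices, so n >= 16 leaves three outside. *)
Lemma outside_path o1 o2 o3 : o1 \notin S -> o2 \notin S -> o3 \notin S -> o1 != o3 ->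
  0 < degree_in S o1 -> 0 < degree_in S o2 -> 0 < degree_in S o3 ->
  adj o1 o2 -> adj o2 o3 -> False.
Proof.
move=> o1S o2S o3S o13 d1 d2 d3 o12 o23.
have o2S' : o2 \notin o1 |: S by rewrite in_setU1 negb_or o2S eq_sym adj_neq.
have o3S' : o3 \notin o2 |: (o1 |: S).
  by rewrite !in_setU1 !negb_or o3S ![o3 == _]eq_sym o13 adj_neq.
have := boundaryU1 o1S; have := boundaryU1 o2S'; have := boundaryU1 o3S'.
have -> : degree_in (o1 |: S) o2 = 1 + degree_in S o2.
  by rewrite /degree_in big_setU1 //= adj_sym o12.
have : 1 + degree_in S o3 <= degree_in (o2 |: (o1 |: S)) o3.
  rewrite /degree_in big_setU1 //= adj_sym o23 leq_add2l big_setU1 //=.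
  exact: leq_addl.
have := no_small_cut (S := o3 |: (o2 |: (o1 |: S))); have := cardsC (o3 |: (o2 |: (o1 |: S))).
rewrite !cardsU1 o1S o2S' o3S' cardS.
by move: bS n16 d1 d2 d3; clear; lia.
Qed.

Lemma inner_edges : adj a1 b1 + adj a1 b2 + adj a2 b1 + adj a2 b2 +
  (adj a1 c1 + adj a1 c2 + adj a2 c1 + adj a2 c2) +
  (adj b1 c1 + adj b1 c2 + adj b2 c1 + adj b2 c2) = 4.
Proof.
have [N Na Nb Nc] := B; have := bad; rewrite (walks_at_neighbours girth5 N).
rewrite (paths3_arms girth5 Na Nb) (paths3_arms girth5 Na Nc) (paths3_arms girth5 Nb Nc).
by rewrite -[8]/(2 * 4) => /eqP; rewrite eqn_pmul2l // => /eqP.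
Qed.

Lemma leaf_degree : degree_in S c1 = 1 + (adj c1 a1 + adj c1 a2 + adj c1 b1 + adj c1 b2).
Proof.
have uL := ball2_uniq girth5 B; have [N Na Nb Nc] := B.
have -> : degree_in S c1 = \sum_(y <- ball2_seq v a b c a1 a2 b1 b2 c1 c2) adj c1 y.
  by rewrite /degree_in big_uniq //; apply: eq_bigl => y; rewrite in_set.
have c12 : adj c1 c2 = false.
  by apply/negP => e; apply: (no_triangle girth5 (x := c) _ e); rewrite Nc.2 !inE eqxx ?orbT.
rewrite /ball2_seq !big_cons big_nil c12 adj_irr; split_uniq uL.
move=> *; have -> : adj c1 v = false by look_up.
have -> : adj c1 a = false by look_up.
have -> : adj c1 b = false by look_up.
have -> : adj c1 c by look_up.
by clear; lia.
Qed.

Lemma leaf_connected : 0 < adj c1 a1 + adj c1 a2 + adj c1 b1 + adj c1 b2.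
Proof.
have c1S : c1 \in S by rewrite in_set !inE eqxx !orbT.
by have := inside_degree c1S; rewrite leaf_degree ltnS.
Qed.

(** By [leaf_degree] such a leaf has only two neighbours in the ball, [c] and [p]. *)
Lemma leaf_third p : adj c1 a1 + adj c1 a2 + adj c1 b1 + adj c1 b2 = 1 ->
  adj c1 p -> p \in [:: a1; a2; b1; b2] ->
  exists2 x, neighbours c1 c p x & x \notin ball2_seq v a b c a1 a2 b1 b2 c1 c2.
Proof.
move=> e1 c1p pL; have [N Na Nb Nc] := B; have uL := ball2_uniq girth5 B.
have c1c : adj c1 c by rewrite adj_sym Nc.2 !inE eqxx orbT.
have pS : p \in S by move: pL; rewrite in_set !inE => /or4P[] /eqP->; rewrite eqxx ?orbT.
have cS : c \in S by rewrite in_set !inE eqxx !orbT.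
have cp : c != p.
  split_uniq uL => *; move: pL; rewrite !inE => /or4P[] /eqP->; by use_neq.
have [x Nx] := neighbours_exists2 cubic c1c c1p cp; exists x => //.
have := degree_in_neighbours S Nx; rewrite leaf_degree e1 pS cS in_set.
by case: (x \in _).
Qed.

End Ball.

(* Up to relabelling, the four edges among the six vertices at distance two from [v] form
   the paths [a1 b1 c1] and [a2 b2 c2] (type A), the path [c1 b1 a1 c2] and the edge [a2 b2]
   (type B), or the paths [a1 b1 c1] and [b2 a2 c2] (type C). *)
Section Types.
Variables v a b c a1 a2 b1 b2 c1 c2 : G.
Hypotheses (n16 : 15 < #|G|) (B : ball2 v a b c a1 a2 b1 b2 c1 c2) (bad : walks_at v = 8).
Local Notation L := (ball2_seq v a b c a1 a2 b1 b2 c1 c2).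

Let uL : uniq L. Proof. exact: ball2_uniq B. Qed.
(** [leaf_third] speaks of the leaf [c1]; these relabellings bring other leaves into its
    position. *)
Let B_bca : ball2 v b c a b1 b2 c1 c2 a1 a2. Proof. permute_ball B. Qed.
Let B_abc' : ball2 v a b c a1 a2 b1 b2 c2 c1. Proof. permute_ball B. Qed.
Let B_bca' : ball2 v b c a b1 b2 c1 c2 a2 a1. Proof. permute_ball B. Qed.
Let B_cab' : ball2 v c a b c1 c2 a1 a2 b2 b1. Proof. permute_ball B. Qed.

Let same x (s : seq G) : x \notin s -> {subset L <= s} -> x \notin L.
Proof. by move=> xs sub; apply: contra xs; apply: sub. Qed.

Lemma unrelated o1 o2 x y : o1 \notin L -> x \in L -> y \in L -> x != y ->
  adj x o1 -> adj y o2 -> o1 != o2.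
Proof.
move=> o1L xL yL xy xo yo; apply: contraNneq xy => e; apply/eqP.
by apply: (outside_unique n16 B bad (o := o1)); rewrite ?in_set // adj_sym // e.
Qed.

Section TypeA.
Hypotheses (e11 : adj a1 b1) (e22 : adj a2 b2) (f11 : adj c1 b1) (f22 : adj c2 b2).

(** One 5-circuit at [a1] passes through [a] and [b1]. Any other uses the outer neighbour [x1] and
    an edge from it to the outer neighbour [x2] of [a2] or [g1] of [c1]; both edges together would
    contradict [outside_path]. *)
Lemma typeA_bound : walks_at a1 <= 4.
Proof.
have [N Na Nb Nc] := B.
(* The four given edges are all the edges between leaves. *)
have : [&& ~~ adj a1 b2, ~~ adj a2 b1, ~~ adj a1 c1, ~~ adj a1 c2, ~~ adj a2 c1, ~~ adj a2 c2,
   ~~ adj b1 c2 & ~~ adj b2 c1].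
  have := inner_edges B bad; rewrite e11 e22 [adj b1 c1]adj_sym [adj b2 c2]adj_sym f11 f22.
  rewrite /= !(addn1, add1n, addnS, addSn) => /eqP.
  by rewrite !eqSS !addn_eq0 !eqb0 -!andbA.
move=> /and5P[/negbTE n1 /negbTE n2 /negbTE n3 /negbTE n4].
move=> /and4P[/negbTE n5 /negbTE n6 /negbTE n7 /negbTE n8].
have mem_l p (s : seq G) : p \in p :: s by rewrite mem_head.
have mem_2 p q (s : seq G) : p \in [:: q, p & s] by rewrite !inE eqxx orbT.
have mem_3 p q r (s : seq G) : p \in [:: q, r, p & s] by rewrite !inE eqxx !orbT.
have [x1 Na1 x1L] : exists2 x, neighbours a1 a b1 x & x \notin L.
  have E : adj a1 b1 + adj a1 b2 + adj a1 c1 + adj a1 c2 = 1 by rewrite e11 n1 n3 n4.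
  have [x Nx xL] := leaf_third B_bca E e11 (mem_l _ _).
  by exists x => //; apply: same xL _ => z; rewrite !inE; do !case: (z == _) => //=.
have [x2 Na2 x2L] : exists2 x, neighbours a2 a b2 x & x \notin L.
  have E : adj a2 b1 + adj a2 b2 + adj a2 c1 + adj a2 c2 = 1 by rewrite e22 n2 n5 n6.
  have [x Nx xL] := leaf_third B_bca' E e22 (mem_2 _ _ _).
  by exists x => //; apply: same xL _ => z; rewrite !inE; do !case: (z == _) => //=.
have [g1 Nc1 g1L] : exists2 x, neighbours c1 c b1 x & x \notin L.
  have E : adj c1 a1 + adj c1 a2 + adj c1 b1 + adj c1 b2 = 1.
    by rewrite f11 ![adj c1 _]adj_sym n3 n5 n8.
  by have [x Nx xL] := leaf_third B E f11 (mem_3 _ _ _ _); exists x.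
split_uniq uL => *.
have Nb1 : neighbours b1 b a1 c1.
  apply: neighbours_of_adj; rewrite 1?adj_sym ?Nb.2 ?inE ?eqxx ?orbT //.
  by rewrite /= !inE; repeat use_neq.
have Nb2 : neighbours b2 b a2 c2.
  apply: neighbours_of_adj; rewrite 1?adj_sym ?Nb.2 ?inE ?eqxx ?orbT //.
  by rewrite /= !inE; repeat use_neq.
split_notin x1L; split_notin x2L; split_notin g1L.
have p1 : paths3 a b1 = 1.
  rewrite (@paths3_two_steps _ girth5 a1 a b1 v a2 b c b2 x2) //; try permute_neighbours.
  by look_up.
have a1x : adj a1 x1 by rewrite Na1.2 mem_3.
have p2 : paths3 a x1 = adj x1 x2.
  rewrite (@paths3_two_steps _ girth5 a1 a x1 v a2 b c b2 x2) //; try permute_neighbours.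
  by rewrite [adj x2 x1]adj_sym; look_up.
have p3 : paths3 b1 x1 = adj g1 x1.
  rewrite (@paths3_two_steps _ girth5 a1 b1 x1 b c1 v b2 c g1) //; try permute_neighbours.
  by look_up.
rewrite (walks_at_neighbours girth5 Na1) p1 p2 p3.
have a2x : adj a2 x2 by rewrite Na2.2 mem_3.
have c1g : adj c1 g1 by rewrite Nc1.2 mem_3.
have [a1L a2L c1L] : [/\ a1 \in L, a2 \in L & c1 \in L] by split; rewrite !inE eqxx ?orbT.
have xg : x2 != g1 by apply: (unrelated x2L a2L c1L).
have deg o u : o \notin L -> u \in L -> adj u o -> o \notin [set z in L] /\ 0 < degree_in [set z in L] o.
  move=> oL uL' uo; rewrite in_set; split=> //.
  by rewrite /degree_in (big_setD1 u) ?in_set //= adj_sym uo.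
case x12: (adj x1 x2); case xg1: (adj g1 x1) => //.
have [x1S x1d] := deg _ _ x1L a1L a1x; have [x2S x2d] := deg _ _ x2L a2L a2x.
have [gS gd] := deg _ _ g1L c1L c1g.
case: (outside_path n16 B bad x2S x1S gS) => //; by rewrite adj_sym.
Qed.

End TypeA.

Section TypeB.
Hypotheses (e11 : adj a1 b1) (e22 : adj a2 b2) (f11 : adj c1 b1) (f22 : adj c2 a1).

(** At [a2] there is one 5-circuit through [a] and [b2], none through [a] and the outer neighbour
    [x2], and at most one through [b2] and [x2], whose outer part is a common neighbour of [x2] and
    [y2]. The bound on [a] shows that [a] does not compete with [v] on the circuit over which [v]
    sends to [b2]. *)
Lemma typeB_bound : walks_at a2 <= 4 /\ walks_at a <= 6.
Proof.
have [N Na Nb Nc] := B.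
have : [&& ~~ adj a1 b2, ~~ adj a2 b1, ~~ adj a1 c1, ~~ adj a2 c1, ~~ adj a2 c2,
   ~~ adj b1 c2, ~~ adj b2 c1 & ~~ adj b2 c2].
  have := inner_edges B bad; rewrite e11 e22 [adj b1 c1]adj_sym [adj a1 c2]adj_sym f11 f22.
  rewrite /= !(addn1, add1n, addnS, addSn) => /eqP.
  by rewrite !eqSS !addn_eq0 !eqb0 -!andbA.
move=> /and5P[/negbTE n1 /negbTE n2 /negbTE n3 /negbTE n4].
move=> /and4P[/negbTE n5 /negbTE n6 /negbTE n7 /negbTE n8].
have mem_l p (s : seq G) : p \in p :: s by rewrite mem_head.
have mem_2 p q (s : seq G) : p \in [:: q, p & s] by rewrite !inE eqxx orbT.
have mem_3 p q r (s : seq G) : p \in [:: q, r, p & s] by rewrite !inE eqxx !orbT.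
have [x2 Na2 x2L] : exists2 x, neighbours a2 a b2 x & x \notin L.
  have E : adj a2 b1 + adj a2 b2 + adj a2 c1 + adj a2 c2 = 1 by rewrite e22 n2 n4 n5.
  have [x Nx xL] := leaf_third B_bca' E e22 (mem_2 _ _ _).
  by exists x => //; apply: same xL _ => z; rewrite !inE; do !case: (z == _) => //=.
have [y2 Nb2 y2L] : exists2 x, neighbours b2 b a2 x & x \notin L.
  have E : adj b2 c1 + adj b2 c2 + adj b2 a1 + adj b2 a2 = 1.
    by rewrite [adj b2 a1]adj_sym [adj b2 a2]adj_sym e22 n1 n7 n8.
  have b2a2 : adj b2 a2 by rewrite adj_sym.
  have [x Nx xL] := leaf_third B_cab' E b2a2 ltac:(by rewrite !inE eqxx !orbT).
  by exists x => //; apply: same xL _ => z; rewrite !inE; do !case: (z == _) => //=.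
have [g2 Nc2 g2L] : exists2 x, neighbours c2 c a1 x & x \notin L.
  have E : adj c2 a1 + adj c2 a2 + adj c2 b1 + adj c2 b2 = 1.
    by rewrite f22 ![adj c2 _]adj_sym n5 n6 n8.
  have [x Nx xL] := leaf_third B_abc' E f22 (mem_l _ _); exists x => //.
  by apply: same xL _ => z; rewrite !inE; do !case: (z == _) => //=.
split_uniq uL => *.
have Nb1 : neighbours b1 b a1 c1.
  apply: neighbours_of_adj; rewrite 1?adj_sym ?Nb.2 ?inE ?eqxx ?orbT //.
  by rewrite /= !inE; repeat use_neq.
have Na1 : neighbours a1 a b1 c2.
  apply: neighbours_of_adj; rewrite 1?adj_sym ?Na.2 ?inE ?eqxx ?orbT //.
    by rewrite adj_sym.
  by rewrite /= !inE; repeat use_neq.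
split_notin x2L; split_notin y2L; split_notin g2L.
have [a2L b2L c2L] : [/\ a2 \in L, b2 \in L & c2 \in L] by split; rewrite !inE eqxx ?orbT.
have a2x : adj a2 x2 by rewrite Na2.2 mem_3.
have b2y : adj b2 y2 by rewrite Nb2.2 mem_3.
have c2g : adj c2 g2 by rewrite Nc2.2 mem_3.
have xg : x2 != g2 by apply: (unrelated x2L a2L c2L).
have xy : y2 != x2 by apply: (unrelated y2L b2L a2L) => //; rewrite eq_sym.
split.
  have p1 : paths3 a b2 = 1.
    rewrite (@paths3_two_steps _ girth5 a2 a b2 v a1 b c b1 c2) //; try permute_neighbours.
    by look_up.
  have p2 : paths3 a x2 = 0.
    rewrite (@paths3_two_steps _ girth5 a2 a x2 v a1 b c b1 c2) //; try permute_neighbours.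
    by look_up.
  have p3 : paths3 b2 x2 <= 1.
    rewrite paths3E (sum_neighbours _ Nb2) (common_adj girth5 a2x) addn0.
    rewrite {1}/common (sum_neighbours _ Nb); look_up.
    by rewrite add0n; apply: common_le1.
  by rewrite (walks_at_neighbours girth5 Na2) p1 p2; move: p3; clear; lia.
have [av aa1 aa2] : [/\ adj a v, adj a a1 & adj a a2] by rewrite !Na.2 mem_l mem_2 mem_3.
have p1 : paths3 v a1 = 2.
  rewrite (@paths3_two_steps _ girth5 a v a1 b c b1 b2 c1 c2) //; try permute_neighbours.
  by look_up.
have p2 : paths3 v a2 = 1.
  rewrite (@paths3_two_steps _ girth5 a v a2 b c b1 b2 c1 c2) //; try permute_neighbours.
  by look_up.
have p3 : paths3 a1 a2 = 0.
  rewrite (@paths3_two_steps _ girth5 a a1 a2 b1 c2 b c1 c g2) //; try permute_neighbours.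
  by look_up.
by rewrite (walks_at_neighbours girth5 Na) p1 p2 p3.
Qed.

End TypeB.

Section TypeC.
Hypotheses (e11 : adj a1 b1) (e22 : adj a2 b2) (f11 : adj c1 b1) (f22 : adj c2 a2).

(** Besides the 5-circuit through [a] and [b1], only [a1 b1 c1 g1 x1] is possible at [a1].
    Exchanging [a1] with [b2], [b1] with [a2] and [c1] with [c2] preserves the type and carries both
    bounds to [b2] and [b]. *)
Lemma typeC_bound : walks_at a1 <= 4 /\ walks_at a <= 6.
Proof.
have [N Na Nb Nc] := B.
have : [&& ~~ adj a1 b2, ~~ adj a2 b1, ~~ adj a1 c1, ~~ adj a1 c2, ~~ adj a2 c1,
   ~~ adj b1 c2, ~~ adj b2 c1 & ~~ adj b2 c2].
  have := inner_edges B bad; rewrite e11 e22 [adj b1 c1]adj_sym [adj a2 c2]adj_sym f11 f22.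
  rewrite /= !(addn1, add1n, addnS, addSn) => /eqP.
  by rewrite !eqSS !addn_eq0 !eqb0 -!andbA.
move=> /and5P[/negbTE n1 /negbTE n2 /negbTE n3 /negbTE n4].
move=> /and4P[/negbTE n5 /negbTE n6 /negbTE n7 /negbTE n8].
have mem_l p (s : seq G) : p \in p :: s by rewrite mem_head.
have mem_2 p q (s : seq G) : p \in [:: q, p & s] by rewrite !inE eqxx orbT.
have mem_3 p q r (s : seq G) : p \in [:: q, r, p & s] by rewrite !inE eqxx !orbT.
have [x1 Na1 x1L] : exists2 x, neighbours a1 a b1 x & x \notin L.
  have E : adj a1 b1 + adj a1 b2 + adj a1 c1 + adj a1 c2 = 1 by rewrite e11 n1 n3 n4.
  have [x Nx xL] := leaf_third B_bca E e11 (mem_l _ _).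
  by exists x => //; apply: same xL _ => z; rewrite !inE; do !case: (z == _) => //=.
have [y2 Nb2 y2L] : exists2 x, neighbours b2 b a2 x & x \notin L.
  have E : adj b2 c1 + adj b2 c2 + adj b2 a1 + adj b2 a2 = 1.
    by rewrite [adj b2 a1]adj_sym [adj b2 a2]adj_sym e22 n1 n7 n8.
  have b2a2 : adj b2 a2 by rewrite adj_sym.
  have [x Nx xL] := leaf_third B_cab' E b2a2 ltac:(by rewrite !inE eqxx !orbT).
  by exists x => //; apply: same xL _ => z; rewrite !inE; do !case: (z == _) => //=.
have [g1 Nc1 g1L] : exists2 x, neighbours c1 c b1 x & x \notin L.
  have E : adj c1 a1 + adj c1 a2 + adj c1 b1 + adj c1 b2 = 1.
    by rewrite f11 ![adj c1 _]adj_sym n3 n5 n7.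
  by have [x Nx xL] := leaf_third B E f11 (mem_3 _ _ _ _); exists x.
have [g2 Nc2 g2L] : exists2 x, neighbours c2 c a2 x & x \notin L.
  have E : adj c2 a1 + adj c2 a2 + adj c2 b1 + adj c2 b2 = 1.
    by rewrite f22 ![adj c2 _]adj_sym n4 n6 n8.
  have [x Nx xL] := leaf_third B_abc' E f22 (mem_2 _ _ _); exists x => //.
  by apply: same xL _ => z; rewrite !inE; do !case: (z == _) => //=.
split_uniq uL => *.
have Nb1 : neighbours b1 b a1 c1.
  apply: neighbours_of_adj; rewrite 1?adj_sym ?Nb.2 ?inE ?eqxx ?orbT //.
  by rewrite /= !inE; repeat use_neq.
have Na2 : neighbours a2 a b2 c2.
  apply: neighbours_of_adj; rewrite 1?adj_sym ?Na.2 ?inE ?eqxx ?orbT //.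
    by rewrite adj_sym.
  by rewrite /= !inE; repeat use_neq.
split_notin x1L; split_notin y2L; split_notin g1L; split_notin g2L.
have [a1L b2L c1L c2L] : [/\ a1 \in L, b2 \in L, c1 \in L & c2 \in L] by split; rewrite !inE eqxx ?orbT.
have a1x : adj a1 x1 by rewrite Na1.2 mem_3.
have b2y : adj b2 y2 by rewrite Nb2.2 mem_3.
have c1g : adj c1 g1 by rewrite Nc1.2 mem_3.
have c2g : adj c2 g2 by rewrite Nc2.2 mem_3.
have xg1 : x1 != g1 by apply: (unrelated x1L a1L c1L).
have xg2 : x1 != g2 by apply: (unrelated x1L a1L c2L).
have xy : x1 != y2 by apply: (unrelated x1L a1L b2L).
split.
  have p1 : paths3 a b1 = 1.
    rewrite (@paths3_two_steps _ girth5 a1 a b1 v a2 b c b2 c2) //; try permute_neighbours.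
    by look_up.
  have p2 : paths3 a x1 = 0.
    rewrite (@paths3_two_steps _ girth5 a1 a x1 v a2 b c b2 c2) //; try permute_neighbours.
    by look_up.
  have p3 : paths3 b1 x1 <= 1.
    rewrite (@paths3_two_steps _ girth5 a1 b1 x1 b c1 v b2 c g1) //; try permute_neighbours.
    by look_up; case: adj.
  by rewrite (walks_at_neighbours girth5 Na1) p1 p2; move: p3; clear; lia.
have [av aa1 aa2] : [/\ adj a v, adj a a1 & adj a a2] by rewrite !Na.2 mem_l mem_2 mem_3.
have p1 : paths3 v a1 = 1.
  rewrite (@paths3_two_steps _ girth5 a v a1 b c b1 b2 c1 c2) //; try permute_neighbours.
  by look_up.
have p2 : paths3 v a2 = 2.
  rewrite (@paths3_two_steps _ girth5 a v a2 b c b1 b2 c1 c2) //; try permute_neighbours.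
  by look_up.
have p3 : paths3 a1 a2 = 0.
  rewrite paths3C (@paths3_two_steps _ girth5 a a2 a1 b2 c2 b y2 c g2) //; try permute_neighbours.
  by look_up.
by rewrite (walks_at_neighbours girth5 Na) p1 p2 p3.
Qed.

End TypeC.
End Types.
End BadVertices.

(** * Discharging *)

Section Discharging.
Variable G : sgraph.
Hypotheses (cubic : regular G 3) (cyc4 : cyclically_edge_connected 4 G) (girth5 : girth_is G 5).
Local Notation T5 := (G * G * G * G * G)%type.
Implicit Types (x y z v a b c : G) (t : T5).

(* [walks_at] counts every 5-circuit twice, so [v] has excess charge when [walks_at v = 8], and
   transfers are measured in quarters of a circuit.  Both the first and the last vertex of [t]
   are opposite to the middle one, whose capacity they share if both of them send. *)
Definition transfer t : nat :=
  if (walks_at t.1.1.1.1 == 8) && (walks_at t.1.1.2 <= 4) then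
    if (walks_at t.1.1.2 <= 2) || (walks_at t.2 != 8) then 2 else 1
  else 0.

Definition sent v := \sum_(t : T5 | walk5 t && (t.1.1.1.1 == v)) transfer t.
Definition received v := \sum_(t : T5 | walk5 t && (t.1.1.2 == v)) transfer t.

Lemma sent_ge v (s : seq T5) : uniq s -> all (fun t => walk5 t && (t.1.1.1.1 == v)) s ->
  \sum_(t <- s) transfer t <= sent v.
Proof.
move=> us /allP sW; rewrite big_uniq //= /sent big_mkcond [leqRHS]big_mkcond.
by apply: leq_sum => t _; case: (boolP (t \in s)) => // /sW ->.
Qed.

Lemma walks_at_even v : ~~ odd (walks_at v).
Proof.
have [a [b [c N]]] := neighbours_exists cubic v.
by rewrite (walks_at_neighbours girth5 N) oddM.
Qed.

Definition rev5 t : T5 := (t.2, t.1.2, t.1.1.2, t.1.1.1.2, t.1.1.1.1).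
Definition rot5 t : T5 := (t.1.1.2, t.1.2, t.2, t.1.1.1.1, t.1.1.1.2).

Lemma rev5K : involutive rev5. Proof. by case=> [[[[]]]]. Qed.

Lemma walk5_rev t : walk5 (rev5 t) = walk5 t.
Proof.
case: t => -[[[v p] q] r] s /=.
rewrite (adj_sym s r) (adj_sym r q) (adj_sym q p) (adj_sym p v) (adj_sym v s).
by case: adj; case: adj; case: adj; case: adj; case: adj.
Qed.

Lemma walks_at_middle v : #|[set t : T5 | walk5 t & t.1.1.2 == v]| = walks_at v.
Proof.
have rotK : injective rot5 by case=> [[[[? ?] ?] ?] ?] [[[[? ?] ?] ?] ?] [-> -> -> -> ->].
rewrite /walks_at -(card_imset _ rotK); apply: eq_card => -[[[[v' p] q] r] s].
rewrite !inE; apply/imsetP/idP => [[[[[[? ?] ?] ?] ?]]|/=].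
  by rewrite inE /= => /andP[/and5P[? ? ? ? ?] ?] [-> -> -> -> ->]; apply/andP; split=> //; apply/and5P.
case/andP=> /and5P[? ? ? ? ?] ?; exists (r, s, v', p, q) => //.
by rewrite inE /=; apply/andP; split=> //; apply/and5P.
Qed.

(* Reversing a walk swaps the two senders. *)
Lemma received_le v : received v <= (if walks_at v <= 4 then 12 - 2 * walks_at v else 0).
Proof.
have [small|big] := leqP (walks_at v) 4; last first.
  rewrite leqn0 sum_nat_eq0; apply/forallP => t; apply/implyP => /andP[_ /eqP e].
  by rewrite /transfer e leqNgt big andbF.
(* A walk and its reversal together bring at most 2, or 4 if [v] lies on at most one 5-circuit. *)
have dbl : received v + received v <=
   \sum_(t : T5 | walk5 t && (t.1.1.2 == v)) (if walks_at v <= 2 then 4 else 2).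
  rewrite {2}/received (reindex_inj (inv_inj rev5K)).
  rewrite (eq_bigl (fun t : T5 => walk5 t && (t.1.1.2 == v))); last first.
    by move=> t; rewrite walk5_rev.
  rewrite -big_split; apply: leq_sum => t /andP[_ /eqP e].
  rewrite /transfer /= e small !andbT; case: (walks_at v <= 2) => /=.
    by case: (_ == 8); case: (_ == 8).
  by case: (_ == 8); case: (_ == 8).
have cnt : \sum_(t : T5 | walk5 t && (t.1.1.2 == v)) (if walks_at v <= 2 then 4 else 2) =
    walks_at v * (if walks_at v <= 2 then 4 else 2).
  by rewrite -[X in _ = X * _]walks_at_middle -sum_nat_const; apply: eq_bigl => t; rewrite inE.
move: dbl small; rewrite {}cnt; move: (received v) (walks_at v) => r [|[|[|[|[|//]]]]] /=; clear; lia.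
Qed.

(** * What a vertex on four 5-circuits sends *)

Lemma typeA_sends v a b c a1 a2 b1 b2 c1 c2 : 15 < #|G| ->
  ball2 v a b c a1 a2 b1 b2 c1 c2 -> walks_at v = 8 ->
  adj a1 b1 -> adj a2 b2 -> adj c1 b1 -> adj c2 b2 -> 4 <= sent v.
Proof.
move=> n16 B bad e1 e2 f1 f2.
have B2 : ball2 v a b c a2 a1 b2 b1 c2 c1 by permute_ball B.
have B3 : ball2 v c b a c1 c2 b1 b2 a1 a2 by permute_ball B.
have B4 : ball2 v c b a c2 c1 b2 b1 a2 a1 by permute_ball B.
have k1 := typeA_bound cubic cyc4 girth5 n16 B bad e1 e2 f1 f2.
have k2 := typeA_bound cubic cyc4 girth5 n16 B2 bad e2 e1 f2 f1.
have k3 := typeA_bound cubic cyc4 girth5 n16 B3 bad f1 f2 e1 e2.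
have k4 := typeA_bound cubic cyc4 girth5 n16 B4 bad f2 f1 e2 e1.
have uL := ball2_uniq girth5 B; have [N Na Nb Nc] := B.
have [adj_v adj_a adj_b adj_c] : [/\ [&& adj v a, adj v b & adj v c], [&& adj a v, adj a a1 & adj a a2],
    [&& adj b v, adj b b1 & adj b b2] & [&& adj c v, adj c c1 & adj c c2]].
  by rewrite !N.2 !Na.2 !Nb.2 !Nc.2 !inE !eqxx !orbT.
case/and3P: adj_v => va vb vc; case/and3P: adj_a => av aa1 aa2.
case/and3P: adj_b => bv bb1 bb2; case/and3P: adj_c => cv cc1 cc2.
(* Four receivers, each of which gets at least one quarter even if the other end of the walk sends
   too. *)
pose s := [:: (v,a,a1,b1,b); (v,a,a2,b2,b); (v,c,c1,b1,b); (v,c,c2,b2,b)].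
have us : uniq s.
  split_uniq uL => *; rewrite /= ?inE ?xpair_eqE; repeat use_neq.
  by rewrite ?andbF.
have ws : all (fun t => walk5 t && (t.1.1.1.1 == v)) s.
  by rewrite /= (adj_sym b1 b) (adj_sym b2 b) va vc aa1 aa2 cc1 cc2 e1 e2 f1 f2 bb1 bb2 bv eqxx.
apply: leq_trans (sent_ge us ws); rewrite !big_cons big_nil /transfer /= bad k1 k2 k3 k4 /=.
by case: (_ || _); case: (_ || _); case: (_ || _); case: (_ || _).
Qed.

Lemma typeB_sends v a b c a1 a2 b1 b2 c1 c2 : 15 < #|G| ->
  ball2 v a b c a1 a2 b1 b2 c1 c2 -> walks_at v = 8 ->
  adj a1 b1 -> adj a2 b2 -> adj c1 b1 -> adj c2 a1 -> 4 <= sent v.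
Proof.
move=> n16 B bad e1 e2 f1 f2.
have B2 : ball2 v b a c b1 b2 a1 a2 c2 c1 by permute_ball B.
have [k1 k2] := typeB_bound cubic cyc4 girth5 n16 B bad e1 e2 f1 f2.
have [k3 k4] : walks_at b2 <= 4 /\ walks_at b <= 6.
  by apply: (typeB_bound cubic cyc4 girth5 n16 B2 bad) => //; rewrite adj_sym.
have uL := ball2_uniq girth5 B; have [N Na Nb Nc] := B.
have [adj_v adj_a adj_b] : [/\ [&& adj v a, adj v b & adj v c], [&& adj a v, adj a a1 & adj a a2]
    & [&& adj b v, adj b b1 & adj b b2]].
  by rewrite !N.2 !Na.2 !Nb.2 !inE !eqxx !orbT.
case/and3P: adj_v => va vb vc; case/and3P: adj_a => av aa1 aa2; case/and3P: adj_b => bv bb1 bb2.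
(* The same circuit in both directions: the receivers are [a2] and [b2], and since neither [a] nor
   [b] sends, each gets two quarters. *)
pose s := [:: (v,a,a2,b2,b); (v,b,b2,a2,a)].
have us : uniq s by split_uniq uL => *; rewrite /= ?inE ?xpair_eqE; repeat use_neq.
have ws : all (fun t => walk5 t && (t.1.1.1.1 == v)) s.
  rewrite /= ?(adj_sym b1 b) ?(adj_sym b2 b) (adj_sym b2 a2) (adj_sym a2 a).
  by rewrite va vb ?aa1 aa2 ?e1 e2 ?bb1 bb2 av bv eqxx.
apply: leq_trans (sent_ge us ws); rewrite !big_cons big_nil /transfer /= bad k1 k3 /=.
have -> : (walks_at a != 8) by apply: contraTneq k2 => ->.
have -> : (walks_at b != 8) by apply: contraTneq k4 => ->.
by rewrite !orbT.
Qed.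

Lemma typeC_sends v a b c a1 a2 b1 b2 c1 c2 : 15 < #|G| ->
  ball2 v a b c a1 a2 b1 b2 c1 c2 -> walks_at v = 8 ->
  adj a1 b1 -> adj a2 b2 -> adj c1 b1 -> adj c2 a2 -> 4 <= sent v.
Proof.
move=> n16 B bad e1 e2 f1 f2.
have B2 : ball2 v b a c b2 b1 a2 a1 c2 c1 by permute_ball B.
have [k1 k2] := typeC_bound cubic cyc4 girth5 n16 B bad e1 e2 f1 f2.
have [k3 k4] : walks_at b2 <= 4 /\ walks_at b <= 6.
  by apply: (typeC_bound cubic cyc4 girth5 n16 B2 bad) => //; rewrite adj_sym.
have uL := ball2_uniq girth5 B; have [N Na Nb Nc] := B.
have [adj_v adj_a adj_b] : [/\ [&& adj v a, adj v b & adj v c], [&& adj a v, adj a a1 & adj a a2]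
    & [&& adj b v, adj b b1 & adj b b2]].
  by rewrite !N.2 !Na.2 !Nb.2 !inE !eqxx !orbT.
case/and3P: adj_v => va vb vc; case/and3P: adj_a => av aa1 aa2; case/and3P: adj_b => bv bb1 bb2.
pose s := [:: (v,a,a1,b1,b); (v,b,b2,a2,a)].
have us : uniq s by split_uniq uL => *; rewrite /= ?inE ?xpair_eqE; repeat use_neq.
have ws : all (fun t => walk5 t && (t.1.1.1.1 == v)) s.
  rewrite /= ?(adj_sym b1 b) ?(adj_sym b2 b) (adj_sym b2 a2) (adj_sym a2 a).
  by rewrite va vb ?aa1 aa2 ?e1 e2 ?bb1 bb2 av bv eqxx.
apply: leq_trans (sent_ge us ws); rewrite !big_cons big_nil /transfer /= bad k1 k3 /=.
have -> : (walks_at a != 8) by apply: contraTneq k2 => ->.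
have -> : (walks_at b != 8) by apply: contraTneq k4 => ->.
by rewrite !orbT.
Qed.

(** Each of [c1], [c2] has a neighbour among the four leaves on the hexagon [a a1 b1 b b2 a2], and
    by girth not the same one. The twelve remaining choices are the three types, up to exchanging
    arms or leaves. *)
Lemma hexagon_sends v a b c a1 a2 b1 b2 c1 c2 : 15 < #|G| ->
  ball2 v a b c a1 a2 b1 b2 c1 c2 -> walks_at v = 8 ->
  adj a1 b1 -> adj a2 b2 -> 4 <= sent v.
Proof.
move=> n16 B bad e1 e2; have [N Na Nb Nc] := B; have uL := ball2_uniq girth5 B.
have e1' : adj b1 a1 by rewrite adj_sym.
have e2' : adj b2 a2 by rewrite adj_sym.
have Bc : ball2 v a b c a1 a2 b1 b2 c2 c1 by permute_ball B.
have Bi : ball2 v a b c a2 a1 b2 b1 c1 c2 by permute_ball B.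
have Bic : ball2 v a b c a2 a1 b2 b1 c2 c1 by permute_ball B.
have Bs : ball2 v b a c b1 b2 a1 a2 c1 c2 by permute_ball B.
have Bsc : ball2 v b a c b1 b2 a1 a2 c2 c1 by permute_ball B.
have d1 := leaf_connected cubic cyc4 girth5 n16 B bad.
have d2 := leaf_connected cubic cyc4 girth5 n16 Bc bad.
have pos (p q r s : bool) : 0 < p + q + r + s -> [|| p, q, r | s] by case: p; case: q; case: r; case: s.
have cc1 : adj c c1 by rewrite Nc.2 !inE eqxx ?orbT.
have cc2 : adj c2 c by rewrite adj_sym Nc.2 !inE eqxx ?orbT.
have sq x : c != x -> adj c1 x -> adj c2 x -> 4 <= sent v.
  move=> cx c1x c2x; case: (no_square girth5 cc1 c1x _ cc2 cx); first by rewrite adj_sym.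
  by split_uniq uL => *; use_neq.
have [ca1 ca2 cb1 cb2] : [/\ c != a1, c != a2, c != b1 & c != b2].
  by split_uniq uL => *.
case/or4P: (pos _ _ _ _ d1) => f1; case/or4P: (pos _ _ _ _ d2) => f2.
- exact: sq f1 f2.
- exact: (typeA_sends n16 Bs).
- exact: (typeB_sends n16 Bc).
- exact: (typeC_sends n16 Bic).
- exact: (typeA_sends n16 Bsc).
- exact: sq f1 f2.
- exact: (typeC_sends n16 Bc).
- exact: (typeB_sends n16 Bic).
- exact: (typeB_sends n16 B).
- exact: (typeC_sends n16 B).
- exact: sq f1 f2.
- exact: (typeA_sends n16 B).
- exact: (typeC_sends n16 Bi).
- exact: (typeB_sends n16 Bi).
- exact: (typeA_sends n16 Bc).
exact: sq f1 f2.
Qed.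

(** Two edges from a leaf to the leaves of one other arm would close a square. *)
Lemma arms_matching v a b a1 a2 b1 b2 : neighbours a v a1 a2 -> neighbours b v b1 b2 ->
  a != b -> adj v a -> adj v b ->
  [/\ ~~ (adj a1 b1 && adj a1 b2), ~~ (adj a2 b1 && adj a2 b2),
      ~~ (adj a1 b1 && adj a2 b1) & ~~ (adj a1 b2 && adj a2 b2)].
Proof.
move=> Na Nb ab va vb.
have key x y x1 x2 y1 y2 : neighbours x v x1 x2 -> neighbours y v y1 y2 ->
    x != y -> adj v x -> adj v y ->
    adj x1 y1 -> adj x1 y2 -> False.
  move=> Nx Ny xy vx vy e1 e2; have /and3P[_ /norP[y12 _] _] := Ny.1.
  apply: (no_square girth5 (x := x1) (y := y1) (z := y) (w := y2)) => //.
  - by rewrite adj_sym Ny.2 !inE eqxx ?orbT.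
  - by rewrite Ny.2 !inE eqxx ?orbT.
  - by rewrite adj_sym.
  apply: contraTneq vy => e; apply/negP => vy; apply: (no_triangle girth5 vx _ vy).
  by rewrite -e Nx.2 !inE eqxx ?orbT.
have Na' := neighbours_swap Na; have Nb' := neighbours_swap Nb; have ba : b != a by rewrite eq_sym.
split; apply/negP => /andP[e1 e2].
- exact: (key a b a1 a2 b1 b2).
- exact: (key a b a2 a1 b1 b2).
- by apply: (key b a b1 b2 a1 a2); rewrite // adj_sym.
by apply: (key b a b2 b1 a1 a2); rewrite // adj_sym.
Qed.

(** Four edges between leaves fall on three pairs of arms, so two of them join the same pair; by
    [arms_matching] they are disjoint and form the hexagon. *)
Lemma bad_sends v : 15 < #|G| -> walks_at v = 8 -> 4 <= sent v.
Proof.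
move=> n16 bad; have [a [b [c [a1 [a2 [b1 [b2 [c1 [c2 B]]]]]]]]] := ball2_exists cubic v.
have [N Na Nb Nc] := B; have := inner_edges girth5 B bad.
have /and3P[/norP[ab /norP[ac _]] /norP[bc _] _] := N.1.
have [va vb vc] : [/\ adj v a, adj v b & adj v c] by rewrite !N.2 !inE !eqxx ?orbT.
have key x y z x1 x2 y1 y2 z1 z2 : ball2 v x y z x1 x2 y1 y2 z1 z2 -> x != y -> adj v x -> adj v y ->
    1 < adj x1 y1 + adj x1 y2 + adj x2 y1 + adj x2 y2 -> 4 <= sent v.
  move=> Bx xy vx vy; have [_ Nx Ny _] := Bx.
  have [m1 m2 m3 m4] := arms_matching Nx Ny xy vx vy.
  case e1: (adj x1 y1); case e4: (adj x2 y2); first by move=> _; apply: hexagon_sends Bx bad e1 e4.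
  - by move: m1 m2 m3 m4; rewrite e1 e4; case: (adj x1 y2); case: (adj x2 y1).
  - by move: m1 m2 m3 m4; rewrite e1 e4; case: (adj x1 y2); case: (adj x2 y1).
  case e2: (adj x1 y2); case e3: (adj x2 y1) => // _.
  have By : ball2 v x y z x1 x2 y2 y1 z1 z2 by permute_ball Bx.
  exact: hexagon_sends By bad e2 e3.
have [lab|] := leqP 2 (adj a1 b1 + adj a1 b2 + adj a2 b1 + adj a2 b2); 
  first by move=> _; apply: key B _ _ _ lab.
have [lac _|] := leqP 2 (adj a1 c1 + adj a1 c2 + adj a2 c1 + adj a2 c2).
  have B' : ball2 v a c b a1 a2 c1 c2 b1 b2 by permute_ball B.
  by move=> _; apply: key B' _ _ _ lac.
have [lbc _ _|] := leqP 2 (adj b1 c1 + adj b1 c2 + adj b2 c1 + adj b2 c2).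
  have B' : ball2 v b c a b1 b2 c1 c2 a1 a2 by permute_ball B.
  by move=> _; apply: key B' _ _ _ lbc.
by move: (_ + adj b2 c2) (_ + adj a2 c2) (_ + adj a2 b2); clear; lia.
Qed.

Lemma walks_le : 15 < #|G| -> #|[set t : T5 | walk5 t]| <= 6 * #|G|.
Proof.
move=> n16.
have total (h : T5 -> G) (F : T5 -> nat) :
    \sum_(t : T5 | walk5 t) F t = \sum_v \sum_(t : T5 | walk5 t && (h t == v)) F t.
  by rewrite (partition_big h predT).
have W : #|[set t : T5 | walk5 t]| = \sum_(v : G) walks_at v.
  rewrite -sum1dep_card (total (fun t => t.1.1.1.1) (fun=> 1)).
  by apply: eq_bigr => v _; rewrite sum1dep_card.
have flow : \sum_(v : G) sent v = \sum_(v : G) received v.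
  by rewrite /sent -(total (fun t => t.1.1.1.1)) /received -(total (fun t => t.1.1.2)).
(* In quarters, 12 stands for the target of three circuits. A vertex on four makes up for its excess
   by sending four quarters, one on three meets the target, and one on at most two has the room
   granted by [received_le]. *)
have : \sum_(v : G) (2 * walks_at v + received v) <= \sum_(v : G) (12 + sent v).
  apply: leq_sum => v _; have := received_le v; have := walks_at_even v.
  have := walks_at_le8 cubic cyc4 girth5 v (leq_trans (isT : 11 < 16) n16).
  have := bad_sends (v := v) n16.
  move: (received v) (sent v) (walks_at v) =>
    r s [|[|[|[|[|[|[|[|[|//]]]]]]]]] //= H _ _; try by clear; lia.
  by move: (H erefl); clear; lia.
have -> : \sum_(v : G) (2 * walks_at v + received v) =
    2 * #|[set t : T5 | walk5 t]| + \sum_(v : G) received v.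
  by rewrite W big_distrr -big_split.
by rewrite big_split /= flow leq_add2r sum_nat_const; move: #|_|; clear; lia.
Qed.

End Discharging.

(** * The Petersen graph *)

Lemma disjoint_pairs (T : finType) (i j k l : T) :
  [disjoint [set i; j] & [set k; l]] = [&& i != k, i != l, j != k & j != l].
Proof. by rewrite disjoints_subset subUset !sub1set !inE !negb_or -!andbA. Qed.

Lemma inord_eq n i j : i < n.+1 -> j < n.+1 -> (inord i == inord j :> 'I_n.+1) = (i == j).
Proof. by move=> li lj; rewrite -val_eqE /= !inordK. Qed.

Section SmallOrder.
Variable G : sgraph.
Hypotheses (cubic : regular G 3) (girth5 : girth_is G 5).
Implicit Types (v a b c : G).

(* The vertices of [petersen] matching [ball2_seq v a b c a1 a2 b1 b2 c1 c2], as pairs. *)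
Definition petersen_pairs : seq (nat * nat) :=
  [:: (0, 1); (2, 3); (2, 4); (3, 4); (1, 4); (0, 4); (1, 3); (0, 3); (0, 2); (1, 2)].

Section Isomorphism.
Variables v a b c a1 a2 b1 b2 c1 c2 : G.
Let L := ball2_seq v a b c a1 a2 b1 b2 c1 c2.
Hypotheses (uL : uniq L) (fullL : forall x, x \in L)
  (N : neighbours v a b c) (Na : neighbours a v a1 a2) (Nb : neighbours b v b1 b2)
  (Nc : neighbours c v c1 c2) (Na1 : neighbours a1 a b2 c1) (Na2 : neighbours a2 a b1 c2)
  (Nb1 : neighbours b1 b a2 c1) (Nb2 : neighbours b2 b a1 c2)
  (Nc1 : neighbours c1 c a1 b1) (Nc2 : neighbours c2 c a2 b2).

Let pair x := nth (0, 0) petersen_pairs (index x L).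
Let lt10 x : index x L < 10. Proof. by rewrite -[10]/(size L) index_mem. Qed.

Let pair_lt x : (pair x).1 < (pair x).2 < 5.
Proof. by rewrite /pair; move: (index x L) (lt10 x) => [|[|[|[|[|[|[|[|[|[|//]]]]]]]]]]. Qed.

Let to_set x : {set 'I_5} := [set inord (pair x).1; inord (pair x).2].

Let card_to_set x : #|to_set x| == 2.
Proof.
have /andP[l1 l2] := pair_lt x.
by rewrite /to_set cards2 inord_eq ?(ltn_trans l1) // (ltn_eqF l1).
Qed.

(** Once adjacency is compared on the table, injectivity follows from girth: vertices with the same
    image have the same neighbours, while distinct vertices share at most one. Both graphs have ten
    vertices. *)
Lemma isomorphic_petersen : isomorphic G petersen.
Proof.
pose f (x : G) : petersen := Sub (to_set x) (card_to_set x).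
have fadj x y : adj (f x) (f y) = adj x y.
  have -> : adj (f x) (f y) = [&& (pair x).1 != (pair y).1, (pair x).1 != (pair y).2,
      (pair x).2 != (pair y).1 & (pair x).2 != (pair y).2].
    have /andP[x1 x2] := pair_lt x; have /andP[y1 y2] := pair_lt y.
    have x1' := ltn_trans x1 x2; have y1' := ltn_trans y1 y2.
    by rewrite /= /petersen_adj /= disjoint_pairs !inord_eq.
  have nthL i j : i < 10 -> j < 10 -> (nth v L i == nth v L j) = (i == j).
    by move=> li lj; rewrite nth_uniq.
  have row i k1 k2 k3 j : j < 10 -> k1 < 10 -> k2 < 10 -> k3 < 10 ->
      neighbours (nth v L i) (nth v L k1) (nth v L k2) (nth v L k3) ->
      adj (nth v L i) (nth v L j) = (j \in [:: k1; k2; k3]).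
    by move=> lj l1 l2 l3 [_ ->]; rewrite !inE !nthL.
  rewrite -[in RHS](nth_index v (fullL x)) -[in RHS](nth_index v (fullL y)) /pair.
  move: (index x L) (lt10 x) (index y L) (lt10 y) => i li j lj.
  move: i li => [|[|[|[|[|[|[|[|[|[|//]]]]]]]]]] _.
  - rewrite (row 0 1 2 3) //; by move: j lj => [|[|[|[|[|[|[|[|[|[|//]]]]]]]]]].
  - rewrite (row 1 0 4 5) //; by move: j lj => [|[|[|[|[|[|[|[|[|[|//]]]]]]]]]].
  - rewrite (row 2 0 6 7) //; by move: j lj => [|[|[|[|[|[|[|[|[|[|//]]]]]]]]]].
  - rewrite (row 3 0 8 9) //; by move: j lj => [|[|[|[|[|[|[|[|[|[|//]]]]]]]]]].
  - rewrite (row 4 1 7 8) //; by move: j lj => [|[|[|[|[|[|[|[|[|[|//]]]]]]]]]].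
  - rewrite (row 5 1 6 9) //; by move: j lj => [|[|[|[|[|[|[|[|[|[|//]]]]]]]]]].
  - rewrite (row 6 2 5 8) //; by move: j lj => [|[|[|[|[|[|[|[|[|[|//]]]]]]]]]].
  - rewrite (row 7 2 4 9) //; by move: j lj => [|[|[|[|[|[|[|[|[|[|//]]]]]]]]]].
  - rewrite (row 8 3 4 6) //; by move: j lj => [|[|[|[|[|[|[|[|[|[|//]]]]]]]]]].
  - rewrite (row 9 3 5 7) //; by move: j lj => [|[|[|[|[|[|[|[|[|[|//]]]]]]]]]].
exists f => //; apply: inj_card_bij => [x y fxy|]; last first.
  have -> : #|G| = 10.
    rewrite -cardsT -[RHS]/(size L); move/card_uniqP: uL => <-; apply: eq_card => x.
    by rewrite inE fullL.
  have := card_draws 'I_5 2; rewrite card_ord cardsE => pairs10.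
  by rewrite card_sig [leqLHS]pairs10.
have adjE z : adj x z = adj y z by rewrite -!fadj fxy.
apply/eqP; apply: contraT => xy.
have [p [q [r [u Nx]]]] := neighbours_exists cubic x.
have [xp xq] : adj x p /\ adj x q by rewrite !Nx !inE !eqxx orbT.
have pq : p != q by case/and3P: u => /norP[].
case: (no_square girth5 (x := x) (y := p) (z := y) (w := q)) => //.
- by rewrite adj_sym -adjE.
- by rewrite -adjE.
by rewrite adj_sym.
Qed.

End Isomorphism.

Lemma order_ge10 v : 10 <= #|G|.
Proof.
have [a [b [c [a1 [a2 [b1 [b2 [c1 [c2 B]]]]]]]]] := ball2_exists cubic v.
have := uniq_leq_size (ball2_uniq girth5 B) (s2 := enum G).
by rewrite -cardE; apply => x _; rewrite mem_enum.
Qed.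

(** The ball is the whole graph, so each leaf has two neighbours among the other leaves, one on each
    other arm by [arms_matching]. When [c1] is joined to [p1] and [q1], girth 5 forces the hexagon
    [c1 q1 p2 c2 q2 p1]. *)
Lemma order10_petersen v : #|G| = 10 -> isomorphic G petersen.
Proof.
move=> n10; have [a [b [c [a1 [a2 [b1 [b2 [c1 [c2 B]]]]]]]]] := ball2_exists cubic v.
have full a' b' c' a1' a2' b1' b2' c1' c2' : ball2 v a' b' c' a1' a2' b1' b2' c1' c2' ->
    forall x, x \in ball2_seq v a' b' c' a1' a2' b1' b2' c1' c2'.
  move=> B' x; have uL := ball2_uniq girth5 B'.
  have [||_ ->] := @uniq_min_size _ (ball2_seq v a' b' c' a1' a2' b1' b2' c1' c2') (enum G) uL.
  - by move=> z _; rewrite mem_enum.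
  - by rewrite -cardE n10.
  by rewrite mem_enum.
have two a' b' c' a1' a2' b1' b2' c1' c2' : ball2 v a' b' c' a1' a2' b1' b2' c1' c2' ->
    adj c1' a1' + adj c1' a2' + adj c1' b1' + adj c1' b2' = 2 /\ a' != b'.
  move=> B'; split; last by case: B' => -[/and3P[/norP[]]].
  have := leaf_degree girth5 B'.
  have [p [q [r Nc']]] := neighbours_exists cubic c1'.
  rewrite (degree_in_neighbours _ Nc') !in_set !(full _ _ _ _ _ _ _ _ _ B').
  by move: (adj c1' a1' : nat) (adj c1' a2' : nat) (adj c1' b1' : nat) (adj c1' b2' : nat); clear; lia.
have key a' b' c' a1' a2' b1' b2' c1' c2' : ball2 v a' b' c' a1' a2' b1' b2' c1' c2' ->
    ((adj c1' a1' && ~~ adj c1' a2') || (~~ adj c1' a1' && adj c1' a2')) &&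
    ((adj c1' b1' && ~~ adj c1' b2') || (~~ adj c1' b1' && adj c1' b2')).
  move=> B'; have [e _] := two _ _ _ _ _ _ _ _ _ B'; have [N' Na' Nb' Nc'] := B'.
  have /and3P[/norP[ab /norP[ac _]] /norP[bc _] _] := N'.1.
  have [va vb vc] : [/\ adj v a', adj v b' & adj v c'] by rewrite !N'.2 !inE !eqxx ?orbT.
  have ca : c' != a' by rewrite eq_sym.
  have cb : c' != b' by rewrite eq_sym.
  have [m1 _ _ _] := arms_matching girth5 Nc' Na' ca vc va.
  have [m2 _ _ _] := arms_matching girth5 Nc' Nb' cb vc vb.
  move: e m1 m2; case: (adj c1' a1'); case: (adj c1' a2') => //;
  by case: (adj c1' b1'); case: (adj c1' b2').
have {B} [p1 [p2 [q1 [q2 [B e1 e2]]]]] : exists p1 p2 q1 q2,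
    [/\ ball2 v a b c p1 p2 q1 q2 c1 c2, adj c1 p1 & adj c1 q1].
  have B2 : ball2 v a b c a2 a1 b1 b2 c1 c2 by permute_ball B.
  have B3 : ball2 v a b c a1 a2 b2 b1 c1 c2 by permute_ball B.
  have B4 : ball2 v a b c a2 a1 b2 b1 c1 c2 by permute_ball B.
  case/andP: (key _ _ _ _ _ _ _ _ _ B) => /orP[]/andP[p1 p2] /orP[]/andP[q1 q2].
  - by exists a1, a2, b1, b2.
  - by exists a1, a2, b2, b1.
  - by exists a2, a1, b1, b2.
  by exists a2, a1, b2, b1.
have [N Na Nb Nc] := B; have uL := ball2_uniq girth5 B.
have /and3P[/norP[ab /norP[ac _]] /norP[bc _] _] := N.1.
have [va vb vc] : [/\ adj v a, adj v b & adj v c] by rewrite !N.2 !inE !eqxx ?orbT.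
have [_ _ ma _] := arms_matching girth5 Nc Na ltac:(by rewrite eq_sym) vc va.
have [_ _ mb _] := arms_matching girth5 Nc Nb ltac:(by rewrite eq_sym) vc vb.
have [_ _ _ md] := arms_matching girth5 Na Nb ab va vb.
have Bc : ball2 v a b c p1 p2 q1 q2 c2 c1 by permute_ball B.
have Bp : ball2 v b c a q1 q2 c1 c2 p1 p2 by permute_ball B.
have Bp' : ball2 v b c a q1 q2 c1 c2 p2 p1 by permute_ball B.
move: ma mb; rewrite e1 e2 /= => /negbTE c2p1 /negbTE c2q1.
have [c2p2 c2q2] : adj c2 p2 /\ adj c2 q2.
  by have := key _ _ _ _ _ _ _ _ _ Bc; rewrite c2p1 c2q1 /= => /andP[].
have p1q1 : adj p1 q1 = false by apply/negP => e; exact: (no_triangle girth5 e1 e e2).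
have p1q2 : adj p1 q2.
  by have := key _ _ _ _ _ _ _ _ _ Bp; rewrite p1q1 /= => /andP[].
have p2q1 : adj p2 q1.
  move: md; rewrite p1q2 /= => /negbTE p2q2.
  by have := key _ _ _ _ _ _ _ _ _ Bp'; rewrite p2q2 andbF orbF /= => /andP[/andP[]].
have [aa1 aa2 bb1 bb2] : [/\ adj a p1, adj a p2, adj b q1 & adj b q2].
  by rewrite !Na.2 !Nb.2 !inE !eqxx !orbT.
have [cc1 cc2] : adj c c1 /\ adj c c2 by rewrite !Nc.2 !inE !eqxx !orbT.
apply: (isomorphic_petersen uL (full _ _ _ _ _ _ _ _ _ B) N Na Nb Nc);
  (apply: neighbours_of_adj; rewrite // 1?adj_sym //; split_uniq uL => *;
   rewrite /= ?inE; repeat use_neq; by []).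
Qed.

End SmallOrder.

Theorem theorem3 (G : sgraph)
  (cubic : regular G 3)
  (cyc4 : cyclically_edge_connected 4 G)
  (girth5 : girth_is G 5)
  (not_petersen : ~ isomorphic G petersen) :
  exists2 M : {set {set G}},
    two_factor M
    & 10 * #|circuits_of_length (spanning_subgraph M) 5| <= #|G|.
Proof.
have [[[|v c] // _ _] _] := girth5.
have n10 : 10 <= #|G| := order_ge10 cubic girth5 v.
have n12 : 11 < #|G|.
  have n10' : #|G| != 10 by apply/eqP => /(order10_petersen cubic girth5 v).
  by have := even_order cubic; move: #|G| n10 n10' => [|[|[|[|[|[|[|[|[|[|[|[|]]]]]]]]]]]].
have [m [mK madj few]] := matching_few_walks cubic cyc4 girth5.
exists (complement_edges m); first exact: two_factor_complement.
have := complement_circuits_le mK madj girth5.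
move: few; set W := [set t | walk5 t]; set Z := [set t | _ & _]; set C := circuits_of_length _ _.
move=> few le_C.
have WE : #|W| = \sum_(x : G) walks_at x.
  rewrite -sum1dep_card (partition_big (fun t : G * G * G * G * G => t.1.1.1.1) predT) //.
  by apply: eq_bigr => x _; rewrite sum1dep_card.
have [n16|n16] := leqP 16 #|G|.
  by have := walks_le cubic cyc4 girth5 n16; rewrite -/W; move: few le_C; clear; lia.
(* Now n is 12 or 14, and [6 * #|Z| <= 8 * n <= 112] gives [#|Z| < 20]: at most one 5-circuit
   remains, and 10 <= n. *)
have W8 : #|W| <= #|G| * 8.
  by rewrite WE -sum_nat_const; apply: leq_sum => x _; apply: walks_at_le8.
have := even_order cubic; move: n12 n16 few le_C W8; move: #|G| #|W| #|Z| #|C|; clear; lia.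
Qed.
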